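(* Let $X := W_0^{1,3}(0,1)$ be the real Sobolev space on the interval $(0,1)$, with continuous dual $X^*$ and duality pairing $\langle\cdot,\cdot\rangle$ between $X^*$ and $X$. Let $F : X \to X^*$ be the (negative) $p$-Laplacian with $p=3$, defined by $$\langle F(u), v\rangle := \int_0^1 |\nabla u(t)|\,\nabla u(t)\,\nabla v(t)\,\mathrm{d}t \qquad \text{for all } u, v \in X,$$ where $\nabla u$ denotes the weak derivative of $u$. Then $F$ is Brezis pseudomonotone, but $F$ is not Ky--Fan hemicontinuous.
   Context: Let $X$ be a real Banach space with continuous dual $X^*$ and duality pairing $\langle\cdot,\cdot\rangle$ between $X^*$ and $X$; $\rightharpoonup$ denotes weak convergence in $X$. Ky--Fan hemicontinuity: a mapping $F : X \to X^*$ is Ky--Fan hemicontinuous if, for every $y \in X$, the function $X \to \mathbb{R}$, $x \mapsto \langle F(x), x-y\rangle$, is weakly sequentially lower semicontinuous, i.e. whenever $x^k \rightharpoonup x$ in $X$, one has $\langle F(x), x-y\rangle \le \liminf_{k\to\infty} \langle F(x^k), x^k-y\rangle$. Brezis pseudomonotonicity: a mapping $F : X \to X^*$ is (Brezis) pseudomonotone if, whenever $\{x^k\} \subseteq X$ is a sequence with $x^k \rightharpoonup x \in X$ and $\limsup_{k\to\infty} \langle F(x^k), x^k - x\rangle \le 0$, then $\langle F(x), x-y\rangle \le \liminf_{k\to\infty} \langle F(x^k), x^k - y\rangle$ for all $y \in X$. *)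

(* Defs.v *)
From HB Require Import structures.
From mathcomp Require Import all_boot all_order all_algebra.
From mathcomp Require Import all_classical all_reals all_analysis.
From mathcomp Require Import measurable_realfun ess_sup_inf.

Set Implicit Arguments.
Unset Strict Implicit.
Unset Printing Implicit Defensive.

Import Order.TTheory GRing.Theory Num.Theory.
Import numFieldNormedType.Exports.

Local Open Scope ring_scope.
Local Open Scope classical_set_scope.

(* The library's type [LspaceType mu p1] is the quotient of L^p functions by
   a.e. equality; here it receives its normed space structure. *)
Section Lspace_normed.
Context d (T : measurableType d) (R : realType).
Variables (mu : {measure set T -> \bar R}) (p : \bar R) (p1 : (1 <= p)%E).

HB.instance Definition _ := gen_eqMixin (LspaceType mu p1).
HB.instance Definition _ := gen_choiceMixin (LspaceType mu p1).

Definition Lfun_of (u : LspaceType mu p1) : T -> R := u : T -> measurableTypeR R.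

Lemma Lspace_measurable (u : LspaceType mu p1) : measurable_fun setT (Lfun_of u).
Proof.
have := @measurable_funPT _ _ _ _ (repr (LebesgueSpace.sort u)).
by [].
Qed.

Lemma Lspace_ext (u v : LspaceType mu p1) :
  Lfun_of u = Lfun_of v %[ae mu] -> u = v.
Proof.
case: u v => [u [[cu]]] [v [[cv]]] uv.
have e : u = v.
  rewrite -(reprK u) -(reprK v); apply/eqP; rewrite eqmodE.
  exact/asboolP.
by subst v; rewrite (Prop_irrelevance cu cv).
Qed.

Lemma eq_Lnorm_ae (f g : T -> R) :
  measurable_fun setT f -> measurable_fun setT g -> f = g %[ae mu] ->
  Lnorm mu p (EFin \o f) = Lnorm mu p (EFin \o g).
Proof.
move=> mf mg fg; rewrite unlock /Lnorm; case: p p1 => [r _| _|//].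
- congr poweR; apply: ge0_ae_eq_integral => //.
  + apply: (measurableT_comp (measurable_poweR _)).
    by apply: measurableT_comp => //; exact/measurable_EFinP.
  + apply: (measurableT_comp (measurable_poweR _)).
    by apply: measurableT_comp => //; exact/measurable_EFinP.
  + by move=> x _; exact: poweR_ge0.
  + by move=> x _; exact: poweR_ge0.
  + by move: fg; rewrite /ae_eq; apply: filterS => x /(_ I) fgx _ /=; rewrite fgx.
- case: ifPn => // _; apply: eq_ess_sup.
  by move: fg; apply: filterS => x /(_ I) fgx /=; rewrite fgx.
Qed.

Definition mfun_of (f : T -> R) (mf : measurable_fun setT f) :
    {mfun T >-> measurableTypeR R} :=
  HB.pack_for {mfun T >-> measurableTypeR R} (f : T -> measurableTypeR R)
    (isMeasurableFun.Build _ _ T (measurableTypeR R) f mf).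

Definition mfun_class (f : T -> R) (mf : measurable_fun setT f) :
    {mfun_ mu, T >-> measurableTypeR R} :=
  \pi_({mfun_ mu, T >-> measurableTypeR R})%qT (mfun_of mf).

Lemma mfun_class_ae (f : T -> R) (mf : measurable_fun setT f) :
  f = (mfun_class mf : T -> measurableTypeR R) %[ae mu].
Proof.
have : (mfun_of mf == repr (mfun_class mf) %[mod {mfun_ mu, T >-> measurableTypeR R}])%qT.
  by rewrite reprK.
by rewrite eqmodE => /asboolP.
Qed.

Lemma Lfun_measurable (f : T -> R) : f \in Lfun mu p -> measurable_fun setT f.
Proof. by move=> /andP[+ _]; rewrite inE. Qed.

Lemma Lclass_subproof (f : T -> R) (fL : f \in Lfun mu p) :
  finite_norm mu p (mfun_class (Lfun_measurable fL)).
Proof.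
have /andP[_] := fL; rewrite inE /= /finite_norm.
rewrite (@eq_Lnorm_ae f _ _ _ (mfun_class_ae (Lfun_measurable fL)))//.
  exact: Lfun_measurable.
by have := @measurable_funPT _ _ _ _ (repr (mfun_class (Lfun_measurable fL))).
Qed.

Definition Lclass (f : T -> R) (fL : f \in Lfun mu p) : LspaceType mu p1 :=
  HB.pack_for (LspaceType mu p1) (mfun_class (Lfun_measurable fL))
    (isFinLebesgue.Build d T R mu p p1 _ (Lclass_subproof fL)).

Lemma LclassE (f : T -> R) (fL : f \in Lfun mu p) :
  f = Lfun_of (Lclass fL) %[ae mu].
Proof. exact: mfun_class_ae. Qed.

Lemma Lspace_Lfun (u : LspaceType mu p1) : Lfun_of u \in Lfun mu p.
Proof.
apply/andP; split; rewrite inE; first exact: Lspace_measurable.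
exact: (@Lebesgue_finite _ _ _ _ _ _ u).
Qed.

Lemma Lfun_linear (a : R) (f g : T -> R) :
  f \in Lfun mu p -> g \in Lfun mu p -> (fun x => a * f x + g x) \in Lfun mu p.
Proof. by have [_] := Lfun_submod_closed mu p1; apply. Qed.

Lemma Lfun_zero : (fun _ => 0) \in Lfun mu p.
Proof. by have [] := Lfun_submod_closed mu p1. Qed.

Lemma Lfun_add (f g : T -> R) :
  f \in Lfun mu p -> g \in Lfun mu p -> (fun x => f x + g x) \in Lfun mu p.
Proof. by move=> fL /(Lfun_linear 1 fL); under eq_fun do rewrite mul1r. Qed.

Lemma Lfun_mull (a : R) (f : T -> R) :
  f \in Lfun mu p -> (fun x => a * f x) \in Lfun mu p.
Proof. by move=> /(Lfun_linear a)/(_ Lfun_zero); under eq_fun do rewrite addr0. Qed.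

Lemma Lfun_opp (f : T -> R) : f \in Lfun mu p -> (fun x => - f x) \in Lfun mu p.
Proof. by move=> /(Lfun_mull (-1)); under eq_fun do rewrite mulN1r. Qed.

Definition Lspace_zero := Lclass Lfun_zero.
Definition Lspace_add (u v : LspaceType mu p1) :=
  Lclass (Lfun_add (Lspace_Lfun u) (Lspace_Lfun v)).
Definition Lspace_opp (u : LspaceType mu p1) := Lclass (Lfun_opp (Lspace_Lfun u)).
Definition Lspace_scale (a : R) (u : LspaceType mu p1) :=
  Lclass (Lfun_mull a (Lspace_Lfun u)).

Let filter_app2 (P Q S : T -> Prop) :
  (\forall x \ae mu, P x -> Q x -> S x) ->
  (\forall x \ae mu, P x) -> (\forall x \ae mu, Q x) -> \forall x \ae mu, S x.
Proof. by apply: filterS3 => x PQS Px Qx; exact: PQS. Qed.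

Let zeroE : (fun _ => 0) = Lfun_of Lspace_zero %[ae mu].
Proof. exact: LclassE. Qed.
Let addE u v : (fun x => Lfun_of u x + Lfun_of v x) = Lfun_of (Lspace_add u v) %[ae mu].
Proof. exact: LclassE. Qed.
Let oppE u : (fun x => - Lfun_of u x) = Lfun_of (Lspace_opp u) %[ae mu].
Proof. exact: LclassE. Qed.
Let scaleE a u : (fun x => a * Lfun_of u x) = Lfun_of (Lspace_scale a u) %[ae mu].
Proof. exact: LclassE. Qed.

Let addA : associative Lspace_add.
Proof.
move=> u v w; apply: Lspace_ext.
move: (addE u v); apply: filter_app.
move: (addE v w) (addE u (Lspace_add v w)) (addE (Lspace_add u v) w).
apply: filterS3 => x e2 e3 e4 e1 _.
by rewrite -e3// -e4// -e1// -e2// addrA.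
Qed.

Let addC : commutative Lspace_add.
Proof.
move=> u v; apply: Lspace_ext; move: (addE u v) (addE v u); apply: filterS2 => x e1 e2 _.
by rewrite -e1// -e2// addrC.
Qed.

Let add0 : left_id Lspace_zero Lspace_add.
Proof.
move=> u; apply: Lspace_ext.
move: (addE Lspace_zero u) zeroE; apply: filterS2 => x e1 e2 _.
by rewrite -e1// -e2// add0r.
Qed.

Let addN : left_inverse Lspace_zero Lspace_opp Lspace_add.
Proof.
move=> u; apply: Lspace_ext.
move: (addE (Lspace_opp u) u) (oppE u) zeroE; apply: filterS3 => x e1 e2 e3 _.
by rewrite -e1// -e2// -e3// addNr.
Qed.

HB.instance Definition _ :=
  GRing.isZmodule.Build (LspaceType mu p1) addA addC add0 addN.

Let scaleA a b u : Lspace_scale a (Lspace_scale b u) = Lspace_scale (a * b) u.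
Proof.
apply: Lspace_ext.
move: (scaleE a (Lspace_scale b u)) (scaleE b u) (scaleE (a * b) u).
apply: filterS3 => x e1 e2 e3 _.
by rewrite -e1// -e2// -e3// mulrA.
Qed.

Let scale1 : left_id 1 Lspace_scale.
Proof.
move=> u; apply: Lspace_ext; move: (scaleE 1 u); apply: filterS => x e1 _.
by rewrite -e1// mul1r.
Qed.

Let scaleDr : right_distributive Lspace_scale +%R.
Proof.
move=> a u v; apply: Lspace_ext.
move: (addE u v) (scaleE a (u + v)); apply: filter_app2.
move: (scaleE a u) (scaleE a v) (addE (Lspace_scale a u) (Lspace_scale a v)).
apply: filterS3 => x e3 e4 e5 e1 e2 _.
by rewrite -e2// -e5// -e3// -e4// -e1// mulrDr.
Qed.

Let scaleDl u : {morph Lspace_scale ^~ u : a b / a + b}.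
Proof.
move=> a b; apply: Lspace_ext.
move: (scaleE a u); apply: filter_app.
move: (scaleE b u) (scaleE (a + b) u) (addE (Lspace_scale a u) (Lspace_scale b u)).
apply: filterS3 => x e2 e3 e4 e1 _.
by rewrite -e3// -e4// -e1// -e2// mulrDl.
Qed.

HB.instance Definition _ :=
  GRing.Zmodule_isLmodule.Build R (LspaceType mu p1) scaleA scale1 scaleDr scaleDl.

Lemma Lfun_ofD u v :
  Lfun_of (u + v) = (fun x => Lfun_of u x + Lfun_of v x) %[ae mu].
Proof. exact/ae_eq_sym/addE. Qed.

Lemma Lfun_ofZ a u : Lfun_of (a *: u) = (fun x => a * Lfun_of u x) %[ae mu].
Proof. exact/ae_eq_sym/scaleE. Qed.

Lemma Lfun_of0 : Lfun_of (0 : LspaceType mu p1) = (fun _ => 0) %[ae mu].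
Proof. exact/ae_eq_sym/zeroE. Qed.

Definition Lspace_norm (u : LspaceType mu p1) : R :=
  fine (Lnorm mu p (EFin \o Lfun_of u)).

Let normE u : (Lspace_norm u)%:E = Lnorm mu p (EFin \o Lfun_of u).
Proof.
rewrite fineK// ge0_fin_numE ?Lnorm_ge0//.
exact: (@Lebesgue_finite _ _ _ _ _ _ u).
Qed.

Let ler_normD u v : Lspace_norm (u + v) <= Lspace_norm u + Lspace_norm v.
Proof.
rewrite -lee_fin EFinD !normE.
rewrite (eq_Lnorm_ae _ _ (Lfun_ofD u v)); last 2 first.
- exact: Lspace_measurable.
- by apply: measurable_funD; exact: Lspace_measurable.
by apply: eminkowski => //; exact: Lspace_measurable.
Qed.

Let normrZ a u : Lspace_norm (a *: u) = `|a| * Lspace_norm u.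
Proof.
apply/EFin_inj; rewrite EFinM !normE.
rewrite (eq_Lnorm_ae _ _ (Lfun_ofZ a u)); last 2 first.
- exact: Lspace_measurable.
- by apply: measurable_funM => //; exact: Lspace_measurable.
exact: (LnormZ (Lfun_Sub p1 (Lspace_Lfun u)) a).
Qed.

Let normr0_eq0 u : Lspace_norm u = 0 -> u = 0.
Proof.
move=> u0; have /(Lnorm_eq0_eq0 _) : Lnorm mu p (EFin \o Lfun_of u) = 0%E.
  by rewrite -normE u0.
have mu_ : measurable_fun setT (EFin \o Lfun_of u).
  by apply/measurable_EFinP; exact: Lspace_measurable.
move=> /(_ mu_ (lt_le_trans lte01 p1)) u0'; apply: Lspace_ext.
move: u0' Lfun_of0; apply: filterS2 => x /(_ I)[ux] e _.
by rewrite e// -ux.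
Qed.

HB.instance Definition _ :=
  Lmodule_isNormed.Build R (LspaceType mu p1) ler_normD normrZ normr0_eq0.

End Lspace_normed.

Section test_functions.
Context {R : realType}.
Implicit Types phi psi u g : R -> R.

(* Lebesgue measure on (0,1), as a measure on the whole line. *)
Definition leb01 : {measure set (measurableTypeR R) -> \bar R} :=
  mrestr lebesgue_measure (measurable_itv `]0, 1[%R).

(* C_c^oo(0,1), each function being extended by 0 to the whole line. *)
Definition test_function phi :=
  [/\ forall n x, derivable (derive1n n phi) x 1,
      compact (closure [set x | phi x != 0]) &
      closure [set x | phi x != 0] `<=` `]0, 1[].

Definition weak_derivative u g := forall phi, test_function phi ->
  \int[lebesgue_measure]_(t in `]0, 1[) (u t * derive1 phi t) =
  - \int[lebesgue_measure]_(t in `]0, 1[) (g t * phi t).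

Let mu := leb01.

#[global] Instance leb01_ae_filter : Filter (nbhs (almost_everywhere leb01)) :=
  ae_filter_ringOfSetsType leb01.

Lemma leb01_fin : mu setT \is a fin_num.
Proof.
rewrite /mu /leb01 /= /mrestr setTI lebesgue_measure_itv /= lte_fin ltr01.
by rewrite -EFinB.
Qed.

Lemma test_function0 : test_function (fun _ => 0).
Proof.
have E : [set x : R | (0 : R) != 0] = set0 by apply/seteqP; split=> x //=; rewrite eqxx.
split; rewrite ?E ?closure0//; last exact: compact0.
move=> n x; suff -> : derive1n n (fun _ : R => 0 : R) = cst 0 by exact: derivable_cst.
elim: n => [//|n IH]; rewrite derive1nS IH.
by apply/funext => y; rewrite derive1E derive_cst.
Qed.

Lemma derive1n_linear a phi psi :
  (forall n x, derivable (derive1n n phi) x 1) -> (forall n x, derivable (derive1n n psi) x 1) ->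
  forall n, derive1n n (fun x => a * phi x + psi x) =
    (fun x => a * derive1n n phi x + derive1n n psi x).
Proof.
move=> sphi spsi; elim=> [//|n IH]; rewrite !derive1nS IH.
apply/funext => x; rewrite !derive1E.
rewrite (_ : (fun x0 => _) = (a \*: derive1n n phi) + derive1n n psi)//.
rewrite deriveD; [|apply: derivableZ; exact: sphi|exact: spsi].
by rewrite deriveZ; [|exact: sphi].
Qed.

Lemma test_function_linear a phi psi :
  test_function phi -> test_function psi -> test_function (fun x => a * phi x + psi x).
Proof.
move=> [sphi cphi iphi] [spsi cpsi ipsi].
have sub : closure [set x | a * phi x + psi x != 0] `<=`
    closure [set x | phi x != 0] `|` closure [set x | psi x != 0].
  rewrite -closureU; apply: closureS => x /= h.
  have [p0|?] := eqVneq (phi x) 0; [right|by left].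
  by move: h; rewrite p0 mulr0 add0r.
split.
- move=> n x; rewrite derive1n_linear//.
  rewrite (_ : (fun x0 => _) = (a \*: derive1n n phi) + derive1n n psi)//.
  by apply: derivableD; [apply: derivableZ; exact: sphi|exact: spsi].
- by apply: (subclosed_compact _ (compactU cphi cpsi) sub); exact: closed_closure.
- by move=> x /sub[/iphi|/ipsi].
Qed.

Lemma smooth_continuous phi : (forall n x, derivable (derive1n n phi) x 1) ->
  forall n, continuous (derive1n n phi).
Proof.
by move=> sphi n x; apply: differentiable_continuous; apply/derivable1_diffP; exact: sphi.
Qed.

Lemma continuous_bounded01 phi : continuous phi ->
  [bounded phi x | x in (`]0%R, 1%R[ : set R)].
Proof.
move=> cphi.
have : bounded_set (phi @` `[0%R, 1%R]).
  apply: compact_bounded; apply: continuous_compact; last exact: segment_compact.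
  exact: continuous_subspaceT.
move=> [M [Mr hM]]; exists M; split=> // r Mr' x /= x01.
apply: (hM r Mr'); exists x => //.
by apply: subset_itv_oo_cc.
Qed.

Lemma integral_leb01 (f : R -> \bar R) : measurable_fun setT f ->
  (\int[mu]_x f x = \int[lebesgue_measure]_(x in `]0%R, 1%R[) f x)%E.
Proof.
pose D := (`]0%R, 1%R[ : set R)%classic.
have mD : measurable D by exact: measurable_itv.
have h (g : R -> \bar R) : measurable_fun setT g -> (forall x, 0 <= g x)%E ->
    (\int[mu]_x g x = \int[lebesgue_measure]_(x in D) g x)%E.
  move=> mg g0.
  rewrite -(setUv D) ge0_integral_setU//=; [|exact: measurableC|by rewrite setUv|exact/disj_setPCl].
  rewrite [X in (_ + X)%E]null_set_integral ?adde0.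
  - apply: eq_measure_integral => A mA AD.
    by rewrite /mu /leb01/= /mrestr setIidl.
  - exact: measurableC.
  - exact: measurable_funTS.
  - by rewrite /mu /leb01 /= /mrestr setICl measure0.
move=> mf; rewrite integralE [RHS]integralE.
by rewrite !h//; [exact: measurable_funeneg|exact: measurable_funepos].
Qed.

Lemma integrable_leb01 (f : R -> R) : mu.-integrable setT (EFin \o f) ->
  lebesgue_measure.-integrable `]0%R, 1%R[ (EFin \o f).
Proof.
move=> /integrableP[mf fin]; apply/integrableP; split.
  exact: measurable_funTS.
by rewrite -integral_leb01//; exact: measurableT_comp.
Qed.

End test_functions.

Section Sobolev.
Context {R : realType}.
Variables (p : \bar R) (p1 : (1 <= p)%E).
Local Notation L := (LspaceType (@leb01 R) p1).
Local Notation leb := (@lebesgue_measure R).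

Let mD : measurable ([set` `]0, 1[%R] : set (measurableTypeR R)).
Proof. exact: measurable_itv. Qed.

Lemma Lspace01_integrable (u : L) : leb.-integrable `]0%R, 1%R[ (EFin \o Lfun_of u).
Proof.
apply: integrable_leb01; apply/Lfun1_integrable.
exact: (Lfun_subset (lexx _) p1 leb01_fin p1 (Lspace_Lfun u)).
Qed.

Lemma Lspace01_integrableM (u : L) (h : R -> R) : continuous h ->
  leb.-integrable `]0%R, 1%R[ (EFin \o (fun t => Lfun_of u t * h t)).
Proof.
move=> ch.
have := integrableMl mD (Lspace01_integrable u)
  (measurable_funTS (continuous_measurable_fun ch)) (continuous_bounded01 ch).
by apply: eq_integrable => // x _ /=; rewrite EFinM.
Qed.

Lemma leb01_ae (P : R -> Prop) : (\forall x \ae @leb01 R, P x) ->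
  \forall x \ae leb, x \in `]0, 1[%R -> P x.
Proof.
move=> [A [mA A0 PA]]; exists (A `&` `]0%R, 1%R[); split=> //.
- exact: measurableI.
- by move=> x /=; rewrite not_implyE => -[x01 nP]; split=> //; exact: PA.
Qed.

Lemma eq_Rintegral01_ae (f g : R -> R) : measurable_fun setT f -> measurable_fun setT g ->
  f = g %[ae @leb01 R] ->
  \int[leb]_(t in `]0, 1[) f t = \int[leb]_(t in `]0, 1[) g t.
Proof.
move=> mf mg /leb01_ae fg; congr fine; apply: ae_eq_integral => //.
- by apply/measurable_EFinP; exact: measurable_funTS.
- by apply/measurable_EFinP; exact: measurable_funTS.
- move: fg; rewrite /ae_eq; apply: filterS.
    exact: (ae_filter_ringOfSetsType leb).
  by move=> x + x01; move=> /(_ x01 I) /= ->.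
Qed.

Lemma Rintegral01_linear (a : R) (u v : L) (h : R -> R) : continuous h ->
  \int[leb]_(t in `]0, 1[) (Lfun_of (a *: u + v) t * h t) =
  a * \int[leb]_(t in `]0, 1[) (Lfun_of u t * h t) +
  \int[leb]_(t in `]0, 1[) (Lfun_of v t * h t).
Proof.
move=> ch.
have mh : measurable_fun setT h by exact: continuous_measurable_fun.
have uh := Lspace01_integrableM u ch.
have auh : leb.-integrable `]0%R, 1%R[ (EFin \o (fun t => a * (Lfun_of u t * h t))).
  have := integrableZl mD a uh.
  by apply: eq_integrable => // x _ /=; rewrite EFinM.
rewrite -RintegralZl// -(RintegralD mD auh (Lspace01_integrableM v ch)).
have mL (w : L) : measurable_fun (setT : set R) (Lfun_of w : R -> R).
  by have := Lspace_measurable w.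
have mLh (w : L) : measurable_fun (setT : set R) (fun t : R => Lfun_of w t * h t).
  by apply: measurable_funM.
apply: eq_Rintegral01_ae.
- exact: mLh.
- by apply: (@measurable_funD _ R R setT (fun t => a * (Lfun_of u t * h t))) => //;
    apply: (@measurable_funM _ R R setT (fun=> a)) => //; exact: mLh.
- move: (Lfun_ofD (a *: u) v) (Lfun_ofZ a u); apply: filterS2 => x e1 e2 _.
  by rewrite e1// e2// mulrDl mulrA.
Qed.

(* W^{1,p}(0,1): the u in L^p that have a weak derivative in L^p.  An element
   is stored as the pair (u, u') of classes; u' is determined by u, since weak
   derivatives are unique a.e. *)
Definition sobolev_pair : {pred L * L} :=
  mem [set w : L * L | weak_derivative (Lfun_of w.1) (Lfun_of w.2)].

Lemma sobolev_pair_submod : submod_closed sobolev_pair.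
Proof.
split; first rewrite inE /=.
  move=> phi [sphi _ _].
  have c1 := @smooth_continuous R _ sphi 1; have c0 := @smooth_continuous R _ sphi 0.
  have I0 h : continuous h -> \int[leb]_(t in `]0, 1[) (Lfun_of (0 : L) t * h t) = 0.
    move=> ch; have := Rintegral01_linear 1 (0 : L) 0 ch.
    rewrite scaler0 addr0 mul1r; set i := Rintegral _ _ _ => /eqP.
    by rewrite -{1}[i]addr0 (inj_eq (addrI i)) eq_sym => /eqP.
  by rewrite !I0// oppr0.
move=> a [u g] [v h]; rewrite !inE /= => ug vh phi tphi.
have [sphi _ _] := tphi.
rewrite (Rintegral01_linear a u v (@smooth_continuous R _ sphi 1)).
rewrite (Rintegral01_linear a g h (@smooth_continuous R _ sphi 0)).
by rewrite ug// vh// opprD mulrN.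
Qed.

HB.instance Definition _ := GRing.isSubmodClosed.Build R _ sobolev_pair sobolev_pair_submod.

Record W1p := MkW1p { W1p_pair :> L * L; _ : W1p_pair \in sobolev_pair }.

HB.instance Definition _ := [isSub for W1p_pair].
HB.instance Definition _ := [Choice of W1p by <:].
HB.instance Definition _ := [SubChoice_isSubLmodule of W1p by <:].

Definition W1p_fun (u : W1p) : R -> R := Lfun_of u.1.
Definition W1p_grad (u : W1p) : R -> R := Lfun_of u.2.

(* Equivalent, for finite p, to the norm (`|u|^p + `|u'|^p)^(1/p). *)
Definition W1p_norm (u : W1p) : R := `|u.1| + `|u.2|.

Lemma W1p_pairD (u v : W1p) : W1p_pair (u + v) = W1p_pair u + W1p_pair v.
Proof. exact: (raddfD val). Qed.

Lemma W1p_pairZ a (u : W1p) : W1p_pair (a *: u) = a *: W1p_pair u.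
Proof. by rewrite -[W1p_pair]/(\val : W1p -> L * L) linearZ. Qed.

Lemma W1p_pair0 : W1p_pair 0 = 0.
Proof. exact: (raddf0 val). Qed.

Lemma W1p_ler_normD u v : W1p_norm (u + v) <= W1p_norm u + W1p_norm v.
Proof. by rewrite /W1p_norm W1p_pairD /= addrACA lerD// ler_normD. Qed.

Lemma W1p_normrZ a u : W1p_norm (a *: u) = `|a| * W1p_norm u.
Proof. by rewrite /W1p_norm W1p_pairZ /= !normrZ mulrDr. Qed.

Lemma W1p_normr0_eq0 u : W1p_norm u = 0 -> u = 0.
Proof.
move=> /eqP; rewrite paddr_eq0// !normr_eq0 => /andP[/eqP u1 /eqP u2].
apply/val_inj; change (W1p_pair u = W1p_pair 0); rewrite W1p_pair0.
by rewrite [W1p_pair u]surjective_pairing u1 u2.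
Qed.

HB.instance Definition _ :=
  Lmodule_isNormed.Build R W1p W1p_ler_normD W1p_normrZ W1p_normr0_eq0.

(* W_0^{1,p}(0,1): the closure in W^{1,p}(0,1) of the test functions. *)
Definition test_class : set W1p :=
  [set u | exists2 phi, test_function phi & W1p_fun u = phi %[ae @leb01 R]].

Definition W01p_pred : {pred W1p} := mem (closure test_class).

Let filter_app2 (P Q S : R -> Prop) :
  (\forall x \ae @leb01 R, P x -> Q x -> S x) ->
  (\forall x \ae @leb01 R, P x) -> (\forall x \ae @leb01 R, Q x) ->
  \forall x \ae @leb01 R, S x.
Proof. by apply: filterS3 => x PQS Px Qx; exact: PQS. Qed.

Lemma W1p_funD u v : W1p_fun (u + v) = (fun x => W1p_fun u x + W1p_fun v x) %[ae @leb01 R].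
Proof. by rewrite /W1p_fun W1p_pairD; exact: Lfun_ofD. Qed.

Lemma W1p_funZ a u : W1p_fun (a *: u) = (fun x => a * W1p_fun u x) %[ae @leb01 R].
Proof. by rewrite /W1p_fun W1p_pairZ; exact: Lfun_ofZ. Qed.

Lemma W1p_gradD u v : W1p_grad (u + v) = (fun x => W1p_grad u x + W1p_grad v x) %[ae @leb01 R].
Proof. by rewrite /W1p_grad W1p_pairD; exact: Lfun_ofD. Qed.

Lemma W1p_gradZ a u : W1p_grad (a *: u) = (fun x => a * W1p_grad u x) %[ae @leb01 R].
Proof. by rewrite /W1p_grad W1p_pairZ; exact: Lfun_ofZ. Qed.

Lemma test_class0 : test_class 0.
Proof.
exists (fun _ => 0); first exact: test_function0.
by rewrite /W1p_fun W1p_pair0; exact: Lfun_of0.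
Qed.

Lemma test_class_linear a u v : test_class u -> test_class v -> test_class (a *: u + v).
Proof.
move=> [phi tphi uphi] [psi tpsi vpsi].
exists (fun x => a * phi x + psi x); first exact: test_function_linear.
move: uphi vpsi; apply: filter_app2.
move: (W1p_funD (a *: u) v) (W1p_funZ a u).
apply: filterS2 => x e3 e4 e1 e2 _.
by rewrite e3// e4// e1// e2.
Qed.

Lemma W01p_submod : submod_closed W01p_pred.
Proof.
split; first by rewrite inE; apply: subset_closure; exact: test_class0.
move=> a u v; rewrite !inE => cu cv.
have lin : (fun z : W1p * W1p => a *: z.1 + z.2) @ (u, v) --> a *: u + v.
  apply: (@cvgD R W1p); last exact: cvg_snd.
  by apply: cvgZl_tmp; exact: cvg_fst.
move=> B /lin [[U V] /= [nU nV] UV].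
have [u' [Tu' Uu']] := cu U nU; have [v' [Tv' Vv']] := cv V nV.
exists (a *: u' + v'); split; first exact: test_class_linear.
exact: (UV (u', v')).
Qed.

HB.instance Definition _ := GRing.isSubmodClosed.Build R _ W01p_pred W01p_submod.

Record W01p := MkW01p { W01p_val :> W1p; _ : W01p_val \in W01p_pred }.

HB.instance Definition _ := [isSub for W01p_val].
HB.instance Definition _ := [Choice of W01p by <:].
HB.instance Definition _ := [SubChoice_isSubLmodule of W01p by <:].

Definition W01p_norm (u : W01p) : R := `|W01p_val u|.

Lemma W01p_valD (u v : W01p) : W01p_val (u + v) = W01p_val u + W01p_val v.
Proof. exact: (raddfD val). Qed.

Lemma W01p_valZ a (u : W01p) : W01p_val (a *: u) = a *: W01p_val u.
Proof. by rewrite -[W01p_val]/(\val : W01p -> W1p) linearZ. Qed.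

Lemma W01p_ler_normD u v : W01p_norm (u + v) <= W01p_norm u + W01p_norm v.
Proof. by rewrite /W01p_norm W01p_valD ler_normD. Qed.

Lemma W01p_normrZ a u : W01p_norm (a *: u) = `|a| * W01p_norm u.
Proof. by rewrite /W01p_norm W01p_valZ normrZ. Qed.

Lemma W01p_normr0_eq0 u : W01p_norm u = 0 -> u = 0.
Proof.
move=> /normr0_eq0 u0; apply/val_inj; rewrite [RHS](raddf0 val).
exact: u0.
Qed.

HB.instance Definition _ := Lmodule_isNormed.Build R W01p
  W01p_ler_normD W01p_normrZ W01p_normr0_eq0.

End Sobolev.

Section duality.
Context {R : realType}.

Record dual (X : normedModType R) := Dual {
  dual_val :> {linear X -> R^o};
  dual_continuous : continuous dual_val }.

Definition weak_cvg (X : normedModType R) (x_ : nat -> X) (x : X) :=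
  forall f : dual X, f (x_ k) @[k --> \oo] --> f x.

Definition ky_fan_hemicontinuous (X : normedModType R) (F : X -> dual X) :=
  forall (y : X) (x_ : nat -> X) (x : X), weak_cvg x_ x ->
    ((F x (x - y))%:E <= limn_einf (fun k => (F (x_ k) (x_ k - y))%:E))%E.

Definition brezis_pseudomonotone (X : normedModType R) (F : X -> dual X) :=
  forall (x_ : nat -> X) (x : X), weak_cvg x_ x ->
    (limn_esup (fun k => (F (x_ k) (x_ k - x))%:E) <= 0)%E ->
    forall y : X,
      ((F x (x - y))%:E <= limn_einf (fun k => (F (x_ k) (x_ k - y))%:E))%E.

End duality.

Section p_laplacian3.
Context {R : realType}.
Local Notation leb := (@lebesgue_measure R).
Local Notation leb01 := (@leb01 R).

Definition W013 : normedModType R := W01p (lee1n 3 : (1 <= 3%:R%:E :> \bar R)%E).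
Local Notation X := W013.

Definition weak_grad (u : X) : R -> R := W1p_grad (W01p_val u).

Definition p_laplacian3_pairing (u v : X) : R :=
  \int[leb]_(t in `]0, 1[) (`|weak_grad u t| * weak_grad u t * weak_grad v t).

Lemma weak_grad_Lfun (u : X) : weak_grad u \in Lfun leb01 3%:R%:E.
Proof. exact: Lspace_Lfun. Qed.

Lemma weak_grad_measurable (u : X) : measurable_fun (setT : set R) (weak_grad u).
Proof. by have := Lfun_measurable (weak_grad_Lfun u). Qed.

Lemma weak_gradD (u v : X) :
  weak_grad (u + v) = (fun x => weak_grad u x + weak_grad v x) %[ae leb01].
Proof. by rewrite /weak_grad W01p_valD; exact: W1p_gradD. Qed.

Lemma weak_gradZ a (u : X) :
  weak_grad (a *: u) = (fun x => a * weak_grad u x) %[ae leb01].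
Proof. by rewrite /weak_grad W01p_valZ; exact: W1p_gradZ. Qed.

Let flux (u : X) (t : R) : R := `|weak_grad u t| * weak_grad u t.

Let flux_measurable (u : X) : measurable_fun (setT : set R) (flux u).
Proof.
apply: measurable_funM; last exact: weak_grad_measurable.
by apply: measurableT_comp => //; exact: weak_grad_measurable.
Qed.

Let flux_finite (u : X) : (Lnorm leb01 (3 / 2)%:E (EFin \o flux u) < +oo)%E.
Proof.
rewrite unlock /Lnorm poweR_lty//.
have /Lfun_integrable : weak_grad u \in Lfun leb01 3%:R%:E by exact: weak_grad_Lfun.
move=> /(_ (ler1n _ 3))/integrableP[_].
move=> h; apply: le_lt_trans h; rewrite le_eqVlt; apply/orP; left; apply/eqP.
apply: eq_integral => x _ /=; rewrite [in RHS]ger0_norm ?powR_ge0//.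
by rewrite /flux normrM normr_id -expr2 -powR_mulrn// -powRrM mulrC divfK.
Qed.

Let flux_hoelder (u v : X) :
  (Lnorm leb01 1 (EFin \o (fun t => (flux u t * weak_grad v t)%R)) <=
   Lnorm leb01 (3 / 2)%:E (EFin \o flux u) * Lnorm leb01 3%:E (EFin \o weak_grad v))%E.
Proof.
apply: (@hoelder _ _ _ leb01 (flux u) (weak_grad v) (3 / 2) 3) => //.
- exact: flux_measurable.
- exact: weak_grad_measurable.
- by rewrite invf_div -[X in _ + X]mul1r -mulrDl -(natrD _ 2 1) divff.
Qed.

Let flux_integrable (u v : X) :
  leb01.-integrable setT (EFin \o (fun t => flux u t * weak_grad v t)).
Proof.
apply/integrableP; split.
  apply/measurable_EFinP; apply: measurable_funM; first exact: flux_measurable.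
  exact: weak_grad_measurable.
rewrite -Lnorm1.
apply: (le_lt_trans (flux_hoelder u v)).
apply: lte_mul_pinfty; first exact: Lnorm_ge0.
  by rewrite ge0_fin_numE ?Lnorm_ge0//; exact: flux_finite.
by have /andP[_] := weak_grad_Lfun v; rewrite inE.
Qed.

Let flux_integrable_leb (u v : X) : leb.-integrable `]0%R, 1%R[
  (EFin \o (fun t => flux u t * weak_grad v t)).
Proof. exact: integrable_leb01. Qed.

Let mD : measurable ([set` `]0, 1[%R] : set (measurableTypeR R)).
Proof. exact: measurable_itv. Qed.

Lemma p_laplacian3_linear (u : X) : linear (p_laplacian3_pairing u : X -> R^o).
Proof.
move=> a v w; rewrite /p_laplacian3_pairing.
have av : leb.-integrable `]0%R, 1%R[ (EFin \o (fun t => a * (flux u t * weak_grad v t))).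
  have := integrableZl mD a (flux_integrable_leb u v).
  by apply: eq_integrable => // x _ /=; rewrite EFinM.
rewrite /GRing.scale /= -RintegralZl//; last exact: flux_integrable_leb.
rewrite -(RintegralD mD av (flux_integrable_leb u w)).
have mfg z : measurable_fun (setT : set R) (fun t : R => flux u t * weak_grad z t).
  by apply: measurable_funM; [exact: flux_measurable|exact: weak_grad_measurable].
apply: eq_Rintegral01_ae.
- exact: mfg.
- apply: (@measurable_funD _ R R setT (fun t => a * (flux u t * weak_grad v t))); last exact: mfg.
  by apply: (@measurable_funM _ R R setT (fun=> a)) => //; exact: mfg.
- move: (weak_gradD (a *: v) w) (weak_gradZ a v); apply: filterS2 => x e1 e2 _.
  by rewrite e1// e2// mulrDr mulrCA.
Qed.

Lemma p_laplacian3_bound (u v : X) : `|p_laplacian3_pairing u v| <=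
  fine (Lnorm leb01 (3 / 2)%:E (EFin \o flux u)) * `|v|.
Proof.
have le1 : `|p_laplacian3_pairing u v| <=
    fine (Lnorm leb01 1 (EFin \o (fun t => flux u t * weak_grad v t))).
  apply: le_trans (le_normr_Rintegral mD (flux_integrable_leb u v)) _.
  rewrite Lnorm1 integral_leb01; first exact: lexx.
  apply: measurableT_comp => //; apply/measurable_EFinP.
  by apply: measurable_funM; [exact: flux_measurable|exact: weak_grad_measurable].
apply: (le_trans le1).
have n3 : (Lnorm leb01 3%:E (EFin \o weak_grad v) < +oo)%E.
  by have /andP[_] := weak_grad_Lfun v; rewrite inE.
apply: (@le_trans _ _ (fine (Lnorm leb01 (3 / 2)%:E (EFin \o flux u)) *
    fine (Lnorm leb01 3%:E (EFin \o weak_grad v)))).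
  rewrite -fineM ?ge0_fin_numE ?Lnorm_ge0 ?flux_finite//.
  rewrite fine_le//.
  - rewrite ge0_fin_numE ?Lnorm_ge0// Lnorm1.
    by have /integrableP[] := flux_integrable u v.
  - by rewrite fin_numM// ge0_fin_numE ?Lnorm_ge0 ?flux_finite.
rewrite ler_wpM2l ?fine_ge0 ?Lnorm_ge0//.
change (`|(W01p_val v).2| <= `|(W01p_val v).1| + `|(W01p_val v).2|).
by rewrite lerDr.
Qed.

Definition p_laplacian3_fun (u : X) : {linear X -> R^o} :=
  HB.pack_for {linear X -> R^o} (p_laplacian3_pairing u : X -> R^o)
    (GRing.isLinear.Build R X R^o *:%R (p_laplacian3_pairing u) (p_laplacian3_linear u)).

Lemma p_laplacian3_continuous (u : X) : continuous (p_laplacian3_pairing u : X -> R^o).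
Proof.
apply: (@bounded_linear_continuous R X R^o (p_laplacian3_fun u)).
apply/linear_boundedP.
near=> r => x; apply: (le_trans (p_laplacian3_bound u x)).
by apply: ler_wpM2r => //; near: r; apply: nbhs_pinfty_ge; rewrite num_real.
Unshelve. all: by end_near. Qed.

Definition p_laplacian3 (u : X) : dual X :=
  @Dual R X (p_laplacian3_fun u) (@p_laplacian3_continuous u).

Lemma p_laplacian3E (u v : X) : p_laplacian3 u v =
  \int[leb]_(t in `]0, 1[) (`|weak_grad u t| * weak_grad u t * weak_grad v t).
Proof. by []. Qed.

End p_laplacian3.

(* Main.v *)
(* F is monotone, and <F(u + t w), w> <= <F(u), w> + C t for 0 < t <= 1, so
   Minty's argument gives pseudomonotonicity.

   F is not Ky-Fan hemicontinuous because its nonlinearity sees oscillations.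
   Let phi be a smooth bump, x its class in X, and
   z_k(t) = 2^-k phi(t) sin(2^k t + theta).  The gradients of the z_k are
   uniformly bounded and, by integration by parts, almost orthogonal:
   |int z_i' z_j'| <= B^2 2^-|i-j|.  So a signed sum of n distinct z_k has norm
   O(n^(2/3)), no functional can exceed a fixed e > 0 on infinitely many z_k,
   and z_k tends weakly to 0.  If F were Ky-Fan hemicontinuous, testing it with
   y = (1 + s) x along x + z_k and x - z_k would give, for every s > 0,
   s (<F(x +- z_k), x> - <F(x), x>) <= C for large k.  Summing over both signs
   and over theta in {0, pi/2}, the left-hand side becomes s times the integral
   of second differences of a |-> |a| a, which is bounded below by a multiple
   of int |phi'|^3 phi^2 > 0, uniformly in k; a contradiction for large s. *)

Require Import Defs.
From mathcomp Require Import all_boot all_order all_algebra.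
From mathcomp Require Import all_classical all_reals all_analysis.
From mathcomp Require Import measurable_realfun ring lra zify.

Set Implicit Arguments.
Unset Strict Implicit.
Unset Printing Implicit Defensive.

Import Order.TTheory GRing.Theory Num.Theory.
Import numFieldNormedType.Exports.

Local Open Scope ring_scope.
Local Open Scope classical_set_scope.

(** * Smooth functions and a bump function *)

Section smooth_functions.
Context {R : realType}.
Implicit Types f g : R -> R.

(** The derivatives are supplied as witnesses instead of being computed by [derive1n], so closure
    under sums, products and affine substitution is an induction on n; [smooth_derivable] translates
    back. *)
Fixpoint Cn n f : Prop :=
  if n is m.+1 then exists2 g, (forall x : R, is_derive x 1 f (g x)) & Cn m g
  else True.

Definition smooth f := forall n, Cn n f.

Lemma CnW n f : Cn n.+1 f -> Cn n f.
Proof.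
elim: n f => [//|n IH] f [g fg Cg].
by exists g => //; exact: IH.
Qed.

Lemma CnD n f g : Cn n f -> Cn n g -> Cn n (fun x => f x + g x).
Proof.
elim: n f g => [//|n IH] f g [df fdf Cdf] [dg gdg Cdg].
exists (fun x => df x + dg x); last exact: IH.
by move=> x; exact: (@is_deriveD R R R f g x 1).
Qed.

Lemma CnM n f g : Cn n f -> Cn n g -> Cn n (fun x => f x * g x).
Proof.
elim: n f g => [//|n IH] f g Cf Cg.
have [df fdf Cdf] := Cf; have [dg gdg Cdg] := Cg.
exists (fun x => f x * dg x + g x * df x).
  by move=> x; exact: (@is_deriveM R R f g x 1).
(* Each term of the product rule keeps one undifferentiated factor, whose order [CnW] lowers to
   n. *)
by apply: CnD; apply: IH => //; exact: CnW.
Qed.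

Lemma Cn_cst n (a : R) : Cn n (fun=> a).
Proof.
by elim: n a => [//|n IH] a; exists (fun=> 0) => // x; exact: (@is_derive_cst R R R).
Qed.

Lemma is_derive_affine f (df : R) (a b x : R) : is_derive (a * x + b) 1 f df ->
  is_derive x 1 (fun t => f (a * t + b)) (a * df).
Proof.
move=> fdf.
have aff : is_derive x 1 (fun t : R => a * t + b) a.
  have := @is_deriveD _ _ _ (a \*: id) (cst b) x 1 _ _
    (@is_deriveZ _ _ _ id a x 1 _ (is_derive_id x 1)) (is_derive_cst b x 1).
  by rewrite /GRing.scale /= mulr1 addr0.
rewrite [a * df]mulrC.
exact: (@is_derive1_comp R f (fun t => a * t + b) x df a fdf aff).
Qed.

Lemma Cn_affine n f (a b : R) : Cn n f -> Cn n (fun x => f (a * x + b)).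
Proof.
elim: n f => [//|n IH] f [df fdf Cdf].
exists (fun x => a * df (a * x + b)); last by apply: CnM; [exact: Cn_cst|exact: IH].
by move=> x; exact: is_derive_affine.
Qed.

Lemma Cn_sin_cos n : Cn n (@sin R) /\ Cn n (@cos R).
Proof.
elim: n => [//|n [IHs IHc]]; split.
  by exists (@cos R) => // x; exact: is_derive_sin.
exists (fun x => (-1) * sin x); last by apply: CnM => //; exact: Cn_cst.
by move=> x; rewrite mulN1r; exact: is_derive_cos.
Qed.

Lemma is_derive_derive1 f g : (forall x : R, is_derive x 1 f (g x)) -> derive1 f = g.
Proof.
move=> fg; apply/funext => x; rewrite derive1E.
by have := fg x => ?; rewrite derive_val.
Qed.

Lemma smooth_derivable f : smooth f -> forall n x, derivable (derive1n n f) x 1.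
Proof.
move=> sf n; have := sf n.+1; elim: n f {sf} => [|n IH] f [g fg Cg] x.
  by have := fg x => ?; exact: ex_derive.
rewrite /derive1n iterSr (is_derive_derive1 fg); exact: IH.
Qed.

Lemma smoothM f g : smooth f -> smooth g -> smooth (fun x => f x * g x).
Proof. by move=> sf sg n; exact: CnM. Qed.

Lemma smooth_affine f (a b : R) : smooth f -> smooth (fun x => f (a * x + b)).
Proof. by move=> sf n; exact: Cn_affine. Qed.

(* The derivatives of [flat_exp 0] are linear combinations of these. *)
Definition flat_exp (n : nat) (x : R) : R :=
  if 0 < x then x ^- n * expR (- x^-1) else 0.

(** Follows from e^y >= y^(n+1) / (n+1)! at y = 1/x. Vanishing at a linear rate is what
    differentiability at the origin needs. *)
Lemma flat_exp_le n (x : R) : 0 < x -> 0 <= flat_exp n x <= n.+1`!%:R * x.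
Proof.
move=> x0; rewrite /flat_exp x0.
have xn0 : 0 < x ^- n by rewrite invr_gt0 exprn_gt0.
rewrite mulr_ge0 ?expR_ge0 ?(ltW xn0)//=.
have xV0 : 0 <= x^-1 by rewrite invr_ge0 ltW.
have := expR_ge1Dxn n xV0.
move=> /(le_trans _)-/(_ (x ^- n.+1 / n.+1`!%:R)).
rewrite exprVn lerDr ler01 => /(_ isT) le.
rewrite expRN ler_pdivrMr ?expR_gt0//.
have fact0 : 0 < n.+1`!%:R :> R by rewrite ltr0n fact_gt0.
have -> : x ^- n = n.+1`!%:R * x * (x ^- n.+1 / n.+1`!%:R).
  rewrite exprS invfM; field.
  by rewrite ?lt0r_neq0// ?exprn_gt0.
by apply: ler_wpM2l => //; rewrite mulr_ge0// ltW.
Qed.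

Lemma is_derive_flat_exp n (x : R) :
  is_derive x 1 (flat_exp n) ((- n%:R) * flat_exp n.+1 x + flat_exp n.+2 x).
Proof.
have [x0|x0|x0] := ltgtP x 0.
- rewrite {2 3}/flat_exp ltNge ltW//= mulr0 addr0.
  apply: (@near_eq_is_derive _ _ _ (cst 0)).
  near=> t; rewrite /flat_exp ltNge ltW//=.
  by near: t; exact: lt_nbhsl.
- have xn0 : x != 0 by rewrite gt_eqF.
  rewrite {2 3}/flat_exp x0.
  have dV : is_derive x 1 (fun t : R => t^-1) (- x ^- 2).
    have := @is_deriveV R id x 1 1 xn0 (is_derive_id x 1).
    by rewrite /GRing.scale /= mulr1.
  have dVn : is_derive x 1 (fun t : R => t ^- n) (n%:R * x ^- n.-1 * (- x^-2)).
    have := @is_deriveX R R (fun t : R => t^-1) n x 1 _ dV.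
    rewrite /GRing.scale /= exprVn -mulr_natl.
    rewrite (_ : (fun t : R => t^-1) ^+ n = (fun t : R => t ^- n)) //.
    by apply/funext => t; rewrite fctE exprVn.
  have dE : is_derive x 1 (fun t : R => expR (- t^-1)) (x ^- 2 * expR (- x^-1)).
    have := @is_derive1_comp R expR (fun t : R => - t^-1) x _ _
      (is_derive_expR _) (@is_deriveN _ _ _ _ _ _ _ dV).
    by rewrite opprK mulrC.
  have dM := @is_deriveM R R _ _ x 1 _ _ dVn dE.
  have E : \forall t \near x, t ^- n * expR (- t^-1) = flat_exp n t.
    near=> t; rewrite /flat_exp ifT//.
    by near: t; exact: lt_nbhsr.
  apply: (near_eq_is_derive E); apply: (is_derive_eq dM).
  rewrite /GRing.scale /= {dM dE E}.
  (* The power rule leaves the truncated exponent [n.-1], so n = 0 is separated before [field]. *)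
  case: n {dVn} => [|n] /=.
    by rewrite !mul0r mulr0 addr0 expr0 invr1 !mul1r oppr0 mul0r add0r.
  rewrite !exprS; field.
  by rewrite expf_neq0.
(* At the origin the difference quotient is 0 on the left and [flat_exp n.+1] on the right, which
   tends to 0 by [flat_exp_le]. *)
- subst x; rewrite {2 3}/flat_exp ltxx mulr0 addr0.
  have cv : h^-1 *: ((flat_exp n \o shift 0) (h *: 1) - flat_exp n 0) @[h --> 0^'] --> (0 : R).
    apply/cvgr0Pnorm_le => e e0.
    have f0 : 0 < n.+2`!%:R :> R by rewrite ltr0n fact_gt0.
    near=> h; rewrite /= /GRing.scale /= mulr1 addr0 {2}/flat_exp ltxx subr0.
    have [h0|h0] := ltP 0 h; last by rewrite /flat_exp ltNge h0 /= mulr0 normr0 ltW.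
    have -> : h^-1 * flat_exp n h = flat_exp n.+1 h.
      by rewrite /flat_exp h0 mulrA -invfM -exprS.
    have /andP[fp fle] := flat_exp_le n.+1 h0.
    rewrite ger0_norm//; apply: (le_trans fle).
    rewrite mulrC -ler_pdivlMr//.
    rewrite -(ger0_norm (ltW h0)).
    near: h.
    by apply: dnbhs0_le; rewrite divr_gt0.
  apply: DeriveDef; first by apply/cvg_ex; exists 0.
  exact: cvg_lim.
Unshelve. all: by end_near. Qed.

Lemma smooth_flat_exp : smooth (flat_exp 0).
Proof.
move=> k; move: 0%N; elim: k => [//|k IH] n.
exists (fun x => (- n%:R) * flat_exp n.+1 x + flat_exp n.+2 x).
  exact: is_derive_flat_exp.
by apply: CnD => //; apply: CnM => //; exact: Cn_cst.
Qed.

(** Positive exactly on (1/4, 3/4), which is compactly contained in (0,1). The arguments have the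
    shape [a * x + b] expected by [smooth_affine]. *)
Definition bump01 (x : R) : R := flat_exp 0 (1 * x + (- 4^-1)) * flat_exp 0 (-1 * x + 3 / 4).

Lemma smooth_bump01 : smooth bump01.
Proof. by apply: smoothM; apply: smooth_affine; exact: smooth_flat_exp. Qed.

Lemma bump01_supp (x : R) : ~~ (4^-1 < x < 3 / 4) -> bump01 x = 0.
Proof.
rewrite negb_and -!leNgt /bump01 /flat_exp => /orP[x1|x2].
  by rewrite [0 < _]ltNge (_ : _ <= _) ?mul0r//; lra.
by rewrite [X in _ * (if X then _ else _)]ltNge (_ : _ <= _) ?mulr0//; lra.
Qed.

Lemma bump01_half : bump01 2^-1 != 0.
Proof.
rewrite /bump01 /flat_exp !ifT; [|lra|lra].
by rewrite !expr0 !mulf_neq0 ?invr1 ?oner_neq0// gt_eqF ?expR_gt0.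
Qed.

Lemma smooth_test_function f : smooth f ->
  (forall x, ~~ (4^-1 < x < 3 / 4) -> f x = 0) -> test_function f.
Proof.
move=> sf f0.
have sub : closure [set x | f x != 0] `<=` `[4^-1, 3 / 4].
  rewrite [X in _ `<=` X](closure_id _).1; last exact: itv_closed.
  apply: closureS => x /= fx; rewrite in_itv/=.
  case: (boolP (4^-1 < x < 3 / 4)) => [/andP[a b]|/f0 fx0].
    by rewrite !ltW.
  by rewrite fx0 eqxx in fx.
split; first exact: smooth_derivable.
  by apply: subclosed_compact sub; [exact: closed_closure|exact: segment_compact].
move=> x /sub; rewrite /= !in_itv /= => /andP[a b].
by apply/andP; split; lra.
Qed.

End smooth_functions.

(** * Test functions as elements of the Sobolev space *)

Section continuous_integrals.
Context {R : realType}.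
Implicit Types f g : R -> R.
Local Notation leb := (@lebesgue_measure R).
Local Notation leb01 := (@leb01 R).

Lemma continuous_funD f g : continuous f -> continuous g -> continuous (fun x => f x + g x).
Proof. by move=> cf cg x; apply: cvgD; [exact: cf|exact: cg]. Qed.

Lemma continuous_funM f g : continuous f -> continuous g -> continuous (fun x => f x * g x).
Proof. by move=> cf cg x; apply: cvgM; [exact: cf|exact: cg]. Qed.

Lemma continuous_funX f n : continuous f -> continuous (fun x => f x ^+ n).
Proof.
move=> cf; elim: n => [|n IH].
  by under eq_fun do rewrite expr0; move=> x; exact: cvg_cst.
by under eq_fun do rewrite exprS; exact: continuous_funM.
Qed.

Lemma continuous_fun_cst (c : R) : continuous (fun _ : R => c).
Proof. by move=> x; exact: cvg_cst. Qed.

Lemma continuous_fun_norm f : continuous f -> continuous (fun x => `|f x|).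
Proof. by move=> cf x; apply: cvg_norm; exact: cf. Qed.

Lemma measurable_oo01 : measurable ([set` `]0, 1[%R] : set (measurableTypeR R)).
Proof. exact: measurable_itv. Qed.

Lemma continuous_integrable_cc01 f : continuous f ->
  leb.-integrable `[0, 1] (EFin \o f).
Proof.
move=> cf; apply: continuous_compact_integrable; first exact: segment_compact.
exact: continuous_subspaceT.
Qed.

Lemma continuous_integrable01 f : continuous f ->
  leb.-integrable `]0, 1[ (EFin \o f).
Proof.
move=> /continuous_integrable_cc01; apply: integrableS => //.
exact: subset_itv_oo_cc.
Qed.

Lemma Rintegral_oo_cc01 f : continuous f ->
  \int[leb]_(t in `]0, 1[) f t = \int[leb]_(t in `[0, 1]) f t.
Proof.
move=> cf; have i1 := continuous_integrable_cc01 cf.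
rewrite Rintegral_itv_bndo_bndc; last exact: continuous_integrable01.
rewrite Rintegral_itv_obnd_cbnd//.
by apply: integrableS i1 => //; apply: subset_itvr; rewrite bnd_simp.
Qed.

Lemma Rintegral01D f g : continuous f -> continuous g ->
  \int[leb]_(t in `]0, 1[) (f t + g t) =
  \int[leb]_(t in `]0, 1[) f t + \int[leb]_(t in `]0, 1[) g t.
Proof.
move=> cf cg.
by rewrite (RintegralD measurable_oo01 (continuous_integrable01 cf) (continuous_integrable01 cg)).
Qed.

Lemma Rintegral01Z (c : R) f : continuous f ->
  \int[leb]_(t in `]0, 1[) (c * f t) = c * \int[leb]_(t in `]0, 1[) f t.
Proof. by move=> cf; rewrite RintegralZl//; exact: continuous_integrable01. Qed.

Lemma is_derive_continuous f g : (forall x : R, is_derive x 1 f (g x)) -> continuous f.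
Proof.
move=> fg x; apply: differentiable_continuous; apply/derivable1_diffP.
by have := fg x => ?; exact: ex_derive.
Qed.

Lemma Rintegral01_derivative f g : (forall x : R, is_derive x 1 f (g x)) ->
  continuous g -> f 0 = 0 -> f 1 = 0 -> \int[leb]_(t in `]0, 1[) g t = 0.
Proof.
move=> fg cg f0 f1; rewrite Rintegral_oo_cc01// /Rintegral.
have cf := is_derive_continuous fg.
rewrite (@continuous_FTC2 _ g f 0 1)//.
- by rewrite f0 f1 subee.
- exact: continuous_subspaceT.
- split; [|exact/cvg_at_right_filter/cf|exact/cvg_at_left_filter/cf].
  by move=> x _; have := fg x => ?; exact: ex_derive.
- by move=> x _; rewrite (is_derive_derive1 fg).
Qed.

Lemma Rintegral01_by_parts f df g dg :
  (forall x : R, is_derive x 1 f (df x)) -> (forall x : R, is_derive x 1 g (dg x)) ->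
  continuous df -> continuous dg -> f 0 * g 0 = 0 -> f 1 * g 1 = 0 ->
  \int[leb]_(t in `]0, 1[) (f t * dg t) = - \int[leb]_(t in `]0, 1[) (df t * g t).
Proof.
move=> fdf gdg cdf cdg e0 e1.
have cf := is_derive_continuous fdf; have cg := is_derive_continuous gdg.
have c1 := continuous_funM cf cdg.
have c2 := continuous_funM cdf cg.
apply/eqP; rewrite -addr_eq0; apply/eqP.
rewrite -Rintegral01D//.
apply: (@Rintegral01_derivative (fun x => f x * g x)) => //.
  move=> x; have := @is_deriveM R R f g x 1 _ _ (fdf x) (gdg x).
  by rewrite /GRing.scale /= [g x * _]mulrC.
exact: continuous_funD.
Qed.

Lemma le_Rintegral01 f g : continuous f -> continuous g ->
  (forall x, 0 < x < 1 -> f x <= g x) ->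
  \int[leb]_(t in `]0, 1[) f t <= \int[leb]_(t in `]0, 1[) g t.
Proof.
move=> cf cg fg; apply: (le_Rintegral measurable_oo01).
- exact: continuous_integrable01.
- exact: continuous_integrable01.
- by move=> x; rewrite /= in_itv /=; exact: fg.
Qed.

Lemma Rintegral01_cst (c : R) : \int[leb]_(t in `]0, 1[) c = c.
Proof.
rewrite Rintegral_cst; last exact: measurable_oo01.
by rewrite /= lebesgue_measure_itv /= lte_fin ltr01 sube0 mulr1.
Qed.

(** By continuity f exceeds [f c / 2] on a ball around c inside (0,1); the closed interval of half
    its radius already contributes a positive amount, and f is nonnegative elsewhere. *)
Lemma Rintegral01_gt0 f (c : R) : continuous f -> (forall x, 0 <= f x) ->
  0 < c < 1 -> 0 < f c -> 0 < \int[leb]_(t in `]0, 1[) f t.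
Proof.
move=> cf f0 c01 fc.
have : \forall x \near c, f c / 2 < f x /\ 0 < x < 1.
  near=> x; split.
    by near: x; apply: (cvgr_gt (f c)); [exact: cf|lra].
  by apply/andP; split; near: x; [apply: lt_nbhsr|apply: lt_nbhsl]; case/andP: c01.
move=> /nbhs_ballP[e /= e0 be].
have sub : (`[c - e / 2, c + e / 2] : set R) `<=` (`]0, 1[ : set R).
  move=> x /=; rewrite in_itv/= => /andP[a b]; rewrite in_itv/=.
  apply: (be x _).2; rewrite /ball /= ltr_norml; apply/andP; split; lra.
have mI : measurable (`[c - e / 2, c + e / 2] : set (measurableTypeR R)) by exact: measurable_itv.
apply: (@lt_le_trans _ _ (\int[leb]_(t in `[c - e / 2, c + e / 2]) (f c / 2))).
  rewrite Rintegral_cst//= lebesgue_measure_itv /= lte_fin.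
  rewrite ifT; last lra.
  rewrite -EFinB /= mulr_gt0//; lra.
have int1 : leb.-integrable `[c - e / 2, c + e / 2] (EFin \o f).
  by apply: integrableS (continuous_integrable01 cf) => //; exact: measurable_oo01.
apply: (@le_trans _ _ (\int[leb]_(t in `[c - e / 2, c + e / 2]) f t)).
  apply: (le_Rintegral mI) => //.
    apply: (@continuous_compact_integrable _ (cst (f c / 2))); first exact: segment_compact.
    by apply: continuous_subspaceT => x; exact: cvg_cst.
  move=> x /=; rewrite in_itv/= => /andP[a b].
  apply/ltW/(be x _).1; rewrite /ball /= ltr_norml; apply/andP; split; lra.
apply: fine_le.
- exact: integrable_fin_num int1.
- exact: integrable_fin_num (continuous_integrable01 cf).
- apply: ge0_subset_integral => //.
    exact: (measurable_int leb (continuous_integrable01 cf)).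
  by move=> x _; rewrite lee_fin.
Unshelve. all: by end_near. Qed.

Lemma continuous_bound01 f : continuous f ->
  exists2 M, 0 < M & forall x, 0 < x < 1 -> `|f x| <= M.
Proof.
move=> /continuous_bounded01 /ex_strict_bound_gt0 [M M0 fM]; exists M => // x x01.
by apply/ltW/fM; rewrite /= in_itv.
Qed.

End continuous_integrals.

(** * Norms of continuous representatives, and the embedding of test functions *)

Section embedding.
Context {R : realType}.
Local Notation leb := (@lebesgue_measure R).
Local Notation leb01 := (@leb01 R).
Local Notation X := (@W013 R).
Local Notation p3 := (lee1n 3 : (1 <= 3%:R%:E :> \bar R)%E).

Lemma Lnorm3E (f : R -> R) : continuous f ->
  Lnorm leb01 3%:R%:E (EFin \o f) =
  ((\int[leb]_(t in `]0, 1[) (`|f t| ^+ 3)) `^ 3^-1)%:E.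
Proof.
move=> cf; rewrite unlock /Lnorm -poweR_EFin; congr poweR.
have cf3 : continuous (fun t => `|f t| ^+ 3).
  exact/continuous_funX/continuous_fun_norm.
rewrite fineK; last exact: integrable_fin_num (continuous_integrable01 cf3).
rewrite -integral_leb01.
  by apply: eq_integral => x _ /=; rewrite powR_mulrn.
by apply/measurable_EFinP; exact: continuous_measurable_fun.
Qed.

Lemma continuous_Lfun3 (f : R -> R) : continuous f -> f \in Lfun leb01 3%:R%:E.
Proof.
move=> cf; apply/andP; split; rewrite inE /=; first exact: continuous_measurable_fun.
by rewrite /finite_norm Lnorm3E// ltry.
Qed.

(** Taking the cube removes the root from the norm, so later estimates compare plain integrals. *)
Lemma Lspace_norm3 (u : LspaceType leb01 p3) (f : R -> R) : continuous f ->
  Lfun_of u = f %[ae leb01] ->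
  `|u| ^+ 3 = \int[leb]_(t in `]0, 1[) (`|f t| ^+ 3).
Proof.
move=> cf uf; rewrite /Num.norm /= /Lspace_norm.
rewrite (eq_Lnorm_ae p3 (Lspace_measurable u) _ uf); last exact: continuous_measurable_fun.
rewrite Lnorm3E//= -powR_mulrn ?powR_ge0// -powRrM mulVf ?powRr1//.
by apply: Rintegral_ge0 => t _; rewrite exprn_ge0.
Qed.

Lemma test_function_cont (phi : R -> R) : test_function phi ->
  continuous phi /\ continuous (derive1 phi).
Proof.
move=> [sphi _ _]; split; first exact: (smooth_continuous sphi (n := 0)).
exact: (smooth_continuous sphi (n := 1)).
Qed.

Lemma test_function_derive (phi : R -> R) : test_function phi ->
  forall x : R, is_derive x 1 phi (derive1 phi x).
Proof. by move=> [sphi _ _] x; rewrite derive1E; apply/derivableP/(sphi 0%N). Qed.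

Lemma test_function_bnd (phi : R -> R) : test_function phi -> phi 0 = 0 /\ phi 1 = 0.
Proof.
move=> [_ _ sub]; split; apply/eqP/negPn/negP => /(@subset_closure _ [set x | phi x != 0]) /sub;
  by rewrite /= in_itv /= ?ltxx ?andbF.
Qed.

(** The classes of phi and its derivative form a Sobolev pair by integration by parts, since phi
    vanishes at 0 and 1; the pair is itself a test class, hence in the closure. *)
Lemma embed_test_function (phi : R -> R) : test_function phi ->
  exists u : X, W1p_fun (W01p_val u) = phi %[ae leb01] /\
    weak_grad u = derive1 phi %[ae leb01].
Proof.
move=> tphi; have [c0 c1] := test_function_cont tphi.
pose u0 : LspaceType leb01 p3 := Lclass p3 (continuous_Lfun3 c0).
pose u1 : LspaceType leb01 p3 := Lclass p3 (continuous_Lfun3 c1).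
have e0 : phi = Lfun_of u0 %[ae leb01] := LclassE p3 (continuous_Lfun3 c0).
have e1 : derive1 phi = Lfun_of u1 %[ae leb01] := LclassE p3 (continuous_Lfun3 c1).
have wd : (u0, u1) \in @sobolev_pair R _ p3.
  rewrite inE /= => psi tpsi; have [d0 d1] := test_function_cont tpsi.
  have mL (w : LspaceType leb01 p3) : measurable_fun (setT : set R) (Lfun_of w : R -> R).
    by have := Lspace_measurable w.
  have mc (h : R -> R) : continuous h -> measurable_fun (setT : set R) h.
    exact: continuous_measurable_fun.
  have E (w : LspaceType leb01 p3) (f h : R -> R) : continuous f -> continuous h ->
      f = Lfun_of w %[ae leb01] ->
      \int[leb]_(t in `]0, 1[) (Lfun_of w t * h t) = \int[leb]_(t in `]0, 1[) (f t * h t).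
    move=> cf ch fw; apply: eq_Rintegral01_ae.
    - by apply: measurable_funM => //; exact: mc.
    - by apply: measurable_funM; exact: mc.
    - by move: fw; apply: filterS => x e _; rewrite e.
  rewrite (E u0 phi)// (E u1 (derive1 phi))//.
  have [p0 p1] := test_function_bnd tphi.
  apply: Rintegral01_by_parts => //; try exact: test_function_derive.
    by rewrite p0 mul0r.
  by rewrite p1 mul0r.
pose v : W1p p3 := MkW1p wd.
have vP : v \in @W01p_pred R _ p3.
  rewrite inE; apply: subset_closure; exists phi => //.
  exact: ae_eq_sym.
by exists (MkW01p vP); split; exact: ae_eq_sym.
Qed.

Lemma W013_normE (u : X) : `|u| = `|(W01p_val u).1| + `|(W01p_val u).2|.
Proof. by []. Qed.

End embedding.

(** * Monotone hemicontinuous maps are pseudomonotone *)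

Section real_limits.
Context {R : realType}.
Implicit Types (a : nat -> R) (c e : R).

Lemma limn_esup_le_near a c : (limn_esup (fun k => (a k)%:E) <= c%:E)%E ->
  forall e, 0 < e -> \forall k \near \oo, a k <= c + e.
Proof.
move=> ac e e0; apply: contrapT => na.
(* The upper limit is an infimum of suprema over eventual sets V; a supremum below [c + e] on one
   such V would make the bound eventual. *)
suff : ((c + e)%:E <= limn_esup (fun k => (a k)%:E))%E.
  by move=> /le_trans/(_ ac); rewrite lee_fin; lra.
apply: le_ereal_inf_tmp => _ [V nV <-].
rewrite leNgt; apply/negP => supV; apply: na.
apply: filterS nV => k Vk; rewrite -lee_fin ltW//.
by apply: le_lt_trans supV; apply: ereal_sup_ubound; exists k.
Qed.

Lemma near_limn_esup_le a c : (forall e, 0 < e -> \forall k \near \oo, a k <= c + e) ->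
  (limn_esup (fun k => (a k)%:E) <= c%:E)%E.
Proof.
move=> ac; apply/lee_addgt0Pr => e e0.
pose V := [set k | a k <= c + e].
apply: (@le_trans _ _ (ereal_sup ((fun k => (a k)%:E) @` V))).
  by apply: ereal_inf_lbound; exists V => //; exact: ac.
by apply: ge_ereal_sup => _ [k Vk <-]; rewrite -EFinD lee_fin.
Qed.

Lemma limn_einf_ge_near a c : (c%:E <= limn_einf (fun k => (a k)%:E))%E ->
  forall e, 0 < e -> \forall k \near \oo, c - e <= a k.
Proof.
rewrite /limn_einf leeNr -EFinN => /limn_esup_le_near h e /h.
by apply: filterS => k; lra.
Qed.

Lemma near_limn_einf_ge a c : (forall e, 0 < e -> \forall k \near \oo, c - e <= a k) ->
  (c%:E <= limn_einf (fun k => (a k)%:E))%E.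
Proof.
move=> h; rewrite /limn_einf leeNr -EFinN; apply: near_limn_esup_le => e /h.
by apply: filterS => k; lra.
Qed.

End real_limits.

Section monotone_pseudomonotone.
Context {R : realType} {X : normedModType R}.
Variable F : X -> dual X.
Hypothesis F_mono : forall u v, 0 <= F u (u - v) - F v (u - v).
Hypothesis F_hemi : forall u w, exists2 C : R, 0 <= C &
  forall t : R, 0 < t <= 1 -> F (u + t *: w) w <= F u w + C * t.

Lemma monotone_hemicontinuous_pseudomonotone : brezis_pseudomonotone F.
Proof.
move=> x_ x xcv sup y; apply: near_limn_einf_ge => e e0.
set w := y - x.
(* Minty's argument: monotonicity between [x_ k] and [x + t *: (y - x)] *)
have [C C0 hC] := F_hemi x w.
(* Chosen so that the hemicontinuity error [C * t] is at most [e / 4]; the added 1 covers C = 0. *)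
pose t : R := Num.min 1 (e / 4 / (C + 1)).
have t0 : 0 < t by rewrite lt_min ltr01 !divr_gt0//; lra.
have t1 : t <= 1 by rewrite ge_min lexx.
have Ct : C * t <= e / 4.
  have : t <= e / 4 / (C + 1) by rewrite ge_min lexx orbT.
  rewrite ler_pdivlMr; last lra.
  by nra.
pose z := x + t *: w.
have wcv u (d : R) : 0 < d -> \forall k \near \oo, `|F u (x_ k - x)| <= d.
  move=> d0; have := xcv (F u) => /cvgrPdist_le /(_ d d0).
  by apply: filterS => k; rewrite distrC linearB.
near=> k.
have h1 : `|F x (x_ k - x)| <= e / 4 by near: k; apply: wcv; lra.
(* The tolerance carries a factor t because the monotonicity inequality at z is divided by t
   below. *)
have h2 : `|F z (x_ k - x)| <= t * e / 8 by near: k; apply: wcv; rewrite !divr_gt0// mulr_gt0.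
have h3 : F (x_ k) (x_ k - x) <= t * e / 8.
  rewrite -[leRHS]add0r; near: k.
  by apply: (limn_esup_le_near sup); rewrite !divr_gt0// mulr_gt0.
(* Together with [h1] this bounds [F (x_ k) (x_ k - x)] from below, complementing the upper bound
   [h3] from the hypothesis on the upper limit. *)
have m1 := F_mono (x_ k) x.
have := F_mono (x_ k) z.
have -> : x_ k - z = (x_ k - x) - t *: w by rewrite /z opprD addrA.
have ez : F (x_ k) ((x_ k - x) - t *: w) = F (x_ k) (x_ k - x) - t * F (x_ k) w.
  by rewrite linearB linearZ.
have ez' : F z ((x_ k - x) - t *: w) = F z (x_ k - x) - t * F z w.
  by rewrite linearB linearZ.
rewrite ez ez' => m2.
have Fz := hC t (introT andP (conj t0 t1)).
have ey : F (x_ k) (x_ k - y) = F (x_ k) (x_ k - x) - F (x_ k) w.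
  by rewrite -linearB /w opprB addrA subrK.
have ex : F x (x - y) = - F x w by rewrite -linearN /w opprB.
rewrite ey ex.
have {}h1 : - (e / 4) <= F x (x_ k - x) by move: h1; rewrite ler_norml => /andP[].
have {}h2 : - (t * e / 8) <= F z (x_ k - x) by move: h2; rewrite ler_norml => /andP[].
rewrite -/z in Fz.
have Fkw : F (x_ k) w <= F z w + e / 4.
  by rewrite -(ler_pM2l t0) mulrDr; lra.
by lra.
Unshelve. all: by end_near. Qed.

End monotone_pseudomonotone.

(** * Pointwise inequalities for the map sending a to |a| a *)

Section signed_square.
Context {R : realFieldType}.
Implicit Types a b r t M : R.

(** For equal signs the product is |a + b| (a - b)^2, for opposite signs (a^2 + b^2) |a - b|. *)
Lemma signed_square_mono a b : 0 <= (`|a| * a - `|b| * b) * (a - b).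
Proof.
have sq (x y : R) : 0 <= x -> 0 <= x * y ^+ 2 by move=> x0; apply: mulr_ge0 => //; exact: sqr_ge0.
have [a0|a0] := ger0P a; have [b0|b0] := ger0P b.
- have := sq (a + b) (a - b); have : 0 <= a + b by lra.
  by move=> /[swap] /[apply]; nra.
- have := mulr_ge0 (addr_ge0 (sqr_ge0 a) (sqr_ge0 b)) (_ : 0 <= a - b).
  by move=> H; have := H (ltac:(lra)); nra.
- have := mulr_ge0 (addr_ge0 (sqr_ge0 a) (sqr_ge0 b)) (_ : 0 <= b - a).
  by move=> H; have := H (ltac:(lra)); nra.
- have := sq (- a - b) (a - b); have : 0 <= - a - b by lra.
  by move=> /[swap] /[apply]; nra.
Qed.

Lemma signed_square_lipschitz a b :
  `|(`|a| * a - `|b| * b)| <= (`|a| + `|b|) * `|a - b|.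
Proof.
have [a0|a0] := ger0P a; have [b0|b0] := ger0P b; have [c0|c0] := ger0P (a - b);
  by rewrite ler_norml; apply/andP; split; nra.
Qed.

Lemma norm_mul_sqr_le a b : `|a| * `|b| ^+ 2 <= `|a| ^+ 3 + `|b| ^+ 3.
Proof.
have := normr_ge0 a; have := normr_ge0 b.
move: `|a| `|b| => {}a {}b b0 a0.
have a20 : 0 <= a ^+ 2 by exact: sqr_ge0.
have b20 : 0 <= b ^+ 2 by exact: sqr_ge0.
have a30 : 0 <= a ^+ 3 by rewrite exprn_ge0.
have b30 : 0 <= b ^+ 3 by rewrite exprn_ge0.
have [ab|/ltW ba] := leP a b.
  have : a * b ^+ 2 <= b * b ^+ 2 by exact: ler_wpM2r.
  by rewrite -exprS; lra.
have : b ^+ 2 <= a ^+ 2 by rewrite ler_sqr.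
move=> /(ler_wpM2l a0); rewrite -exprS; lra.
Qed.

(** The Lipschitz bound and |a + t b| <= |a| + |b| give an error of t (2 |a| |b|^2 + |b|^3). Cubes
    appear on the right because they are integrable for gradients in L^3. *)
Lemma signed_square_hemi a b t : 0 < t <= 1 ->
  `|a + t * b| * (a + t * b) * b <= `|a| * a * b + 4 * t * (`|a| ^+ 3 + `|b| ^+ 3).
Proof.
move=> /andP[t0 t1].
have := signed_square_lipschitz (a + t * b) a.
rewrite addrAC subrr add0r normrM (gtr0_norm t0) => lip.
have nt : `|a + t * b| <= `|a| + `|b|.
  rewrite (le_trans (ler_normD _ _))// lerD2l normrM (gtr0_norm t0).
  by rewrite ler_piMl.
have ab := norm_mul_sqr_le a b.
have a30 : 0 <= `|a| ^+ 3 by rewrite exprn_ge0.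
have : (`|a + t * b| * (a + t * b) - `|a| * a) * b <=
    `|(`|a + t * b| * (a + t * b) - `|a| * a)| * `|b|.
  by rewrite -normrM ler_norm.
move=> /le_trans/(_ (ler_wpM2r (normr_ge0 b) lip)).
have le2 : (`|a + t * b| + `|a|) * (t * `|b|) * `|b| <=
    (`|a| + `|b| + `|a|) * (t * `|b|) * `|b|.
  by rewrite ler_wpM2r// ler_wpM2r ?lerD2r// mulr_ge0// ltW.
move=> /le_trans/(_ le2).
have -> : (`|a| + `|b| + `|a|) * (t * `|b|) * `|b| =
  t * (2 * (`|a| * `|b| ^+ 2) + `|b| ^+ 3) by ring.
have : t * (2 * (`|a| * `|b| ^+ 2) + `|b| ^+ 3) <= t * (4 * (`|a| ^+ 3 + `|b| ^+ 3)).
  have b30 : 0 <= `|b| ^+ 3 by rewrite exprn_ge0.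
  by rewrite ler_pM2l//; lra.
by rewrite mulrBl; lra.
Qed.

(** Both sides are even in r and in a, so a, r >= 0. If r <= a, the second difference is 2 r^2 and
    a^2 <= M^2 suffices; otherwise its product with a is 2 a^3 + 4 a^2 (r - a) and r^2 <= M^2
    suffices. Taking r to be an oscillating gradient turns this into a lower bound that survives
    weak convergence. *)
Lemma signed_square_second_difference a r M : `|a| <= M -> `|r| <= M ->
  `|a| ^+ 3 * r ^+ 2 <= M ^+ 2 *
  ((`|a + r| * (a + r) + `|a - r| * (a - r) - 2 * (`|a| * a)) * a).
Proof.
wlog r0 : r / 0 <= r => [H aM rM|].
  have [r0|r0] := leP 0 r; first exact: H.
  have := H (- r); rewrite normrN sqrrN opprK [X in _ * ((X - _) * _)]addrC.
  by apply => //; rewrite oppr_ge0 ltW.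
wlog a0 : a / 0 <= a => [H aM rM|].
  have [a0|a0] := leP 0 a; first exact: H.
  have Na0 : 0 <= - a by rewrite oppr_ge0 ltW.
  have := H (- a) Na0; rewrite normrN => /(_ aM rM) /le_trans; apply.
  have -> : - a + r = - (a - r) by ring.
  have -> : - a - r = - (a + r) by ring.
  by rewrite !normrN le_eqVlt; apply/orP; left; apply/eqP; ring.
rewrite (ger0_norm a0) (ger0_norm r0) => aM rM.
rewrite (ger0_norm (addr_ge0 a0 r0)).
have a20 : 0 <= a ^+ 2 by exact: sqr_ge0.
have r20 : 0 <= r ^+ 2 by exact: sqr_ge0.
have a30 : 0 <= a ^+ 3 by rewrite exprn_ge0.
have aM2 : a ^+ 2 <= M ^+ 2 by rewrite ler_sqr ?nnegrE// (le_trans a0).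
have rM2 : r ^+ 2 <= M ^+ 2 by rewrite ler_sqr ?nnegrE// (le_trans r0).
have [ar|/ltW ra] := leP 0 (a - r).
  rewrite (ger0_norm ar).
  have -> : ((a + r) * (a + r) + (a - r) * (a - r) - 2 * (a * a)) * a = 2 * (a * r ^+ 2).
    by ring.
  have ar2 : 0 <= a * r ^+ 2 by exact: mulr_ge0.
  have := ler_wpM2r ar2 aM2; have := mulr_ge0 (sqr_ge0 M) ar2.
  have -> : a ^+ 3 * r ^+ 2 = a ^+ 2 * (a * r ^+ 2) by ring.
  by lra.
rewrite (ler0_norm ra).
have -> : ((a + r) * (a + r) + - (a - r) * (a - r) - 2 * (a * a)) * a =
  2 * a ^+ 3 + 4 * (a ^+ 2 * (r - a)) by ring.
have := ler_wpM2l a30 rM2.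
have h : 0 <= a ^+ 2 * (r - a) by apply: mulr_ge0 => //; lra.
have := mulr_ge0 (sqr_ge0 M) h; have := mulr_ge0 (sqr_ge0 M) a30.
rewrite mulrDr; lra.
Qed.

End signed_square.

(** * Monotonicity and hemicontinuity of the 3-Laplacian *)

Section p_laplacian.
Context {R : realType}.
Local Notation leb := (@lebesgue_measure R).
Local Notation leb01 := (@leb01 R).
Local Notation X := (@W013 R).
Implicit Types u v w : X.

(** The difference g - f agrees almost everywhere with its absolute value, whose integral is
    nonnegative. *)
Lemma le_Rintegral01_ae (f g : R -> R) :
  measurable_fun setT f -> measurable_fun setT g ->
  leb.-integrable `]0, 1[ (EFin \o f) -> leb.-integrable `]0, 1[ (EFin \o g) ->
  (\forall x \ae leb01, f x <= g x) ->
  \int[leb]_(t in `]0, 1[) f t <= \int[leb]_(t in `]0, 1[) g t.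
Proof.
move=> mf mg fi gi fg; rewrite -subr_ge0 -(RintegralB measurable_oo01 gi fi).
rewrite (@eq_Rintegral01_ae _ _ (fun t => `|g t - f t|)).
- exact: Rintegral_ge0.
- exact: measurable_funB.
- by apply: measurableT_comp => //; exact: measurable_funB.
- by move: fg; apply: filterS => x fgx _; rewrite ger0_norm// subr_ge0.
Qed.

Lemma weak_grad_cube_integrable u :
  leb.-integrable `]0, 1[ (EFin \o (fun t => `|weak_grad u t| ^+ 3)).
Proof.
apply: integrable_leb01.
have := Lfun_integrable (ler1n _ 3) (weak_grad_Lfun u).
by apply: eq_integrable => // x _ /=; rewrite powR_mulrn.
Qed.

Lemma flux_measurable u v :
  measurable_fun (setT : set R) (fun t : R => `|weak_grad u t| * weak_grad u t * weak_grad v t).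
Proof.
apply: measurable_funM; last exact: weak_grad_measurable.
apply: measurable_funM; last exact: weak_grad_measurable.
by apply: measurableT_comp => //; exact: weak_grad_measurable.
Qed.

Lemma flux_integrable01 u v :
  leb.-integrable `]0, 1[ (EFin \o (fun t => `|weak_grad u t| * weak_grad u t * weak_grad v t)).
Proof.
have := integrableD measurable_oo01 (weak_grad_cube_integrable u) (weak_grad_cube_integrable v).
apply: le_integrable => //.
  by apply/measurable_EFinP/measurable_funTS; exact: flux_measurable.
move=> x _ /=; rewrite lee_fin !normrM normr_id mulrC -expr2.
(* The sum of the two cubes dominates the flux, so no Hölder inequality is needed here. *)
apply: le_trans (norm_mul_sqr_le _ _) _.
by rewrite addrC ler_norm.
Qed.

Lemma p_laplacian3_mono u v : 0 <= p_laplacian3 u (u - v) - p_laplacian3 v (u - v).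
Proof.
rewrite !p_laplacian3E subr_ge0; apply: le_Rintegral01_ae.
- exact: flux_measurable.
- exact: flux_measurable.
- exact: flux_integrable01.
- exact: flux_integrable01.
move: (weak_gradD u (- v)) (weak_gradZ (-1) v); apply: filterS2 => x.
rewrite scaleN1r => /(_ I) -> /(_ I) ->.
by rewrite -subr_ge0 -mulrBl mulN1r; exact: signed_square_mono.
Qed.

Lemma p_laplacian3_hemi u w : exists2 C : R, 0 <= C & forall t : R, 0 < t <= 1 ->
  p_laplacian3 (u + t *: w) w <= p_laplacian3 u w + C * t.
Proof.
pose cube := fun t => `|weak_grad u t| ^+ 3 + `|weak_grad w t| ^+ 3.
have icube : leb.-integrable `]0, 1[ (EFin \o cube).
  exact: (integrableD measurable_oo01 (weak_grad_cube_integrable u)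
    (weak_grad_cube_integrable w)).
have mcube : measurable_fun (setT : set R) (cube : R -> R).
  have m3 v : measurable_fun (setT : set R) (fun t : R => `|weak_grad v t| ^+ 3).
    by apply: measurable_funX; apply: measurableT_comp => //; exact: weak_grad_measurable.
  exact: measurable_funD.
exists (4 * \int[leb]_(t in `]0, 1[) cube t).
  by rewrite mulr_ge0//; apply: Rintegral_ge0 => t _; rewrite addr_ge0// exprn_ge0.
move=> t t01; rewrite !p_laplacian3E mulrAC -(RintegralZl _ measurable_oo01 icube).
have itcube : leb.-integrable `]0, 1[ (EFin \o (fun s => 4 * t * cube s)).
  have := integrableZl measurable_oo01 (4 * t) icube.
  by apply: eq_integrable => // x _ /=; rewrite EFinM.
have mtcube : measurable_fun (setT : set R) (fun s : R => 4 * t * cube s).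
  by apply: (@measurable_funM _ R R setT (fun=> 4 * t)).
rewrite -(RintegralD measurable_oo01 (flux_integrable01 u w) itcube).
apply: le_Rintegral01_ae.
- exact: flux_measurable.
- by apply: (@measurable_funD _ R R setT) => //; exact: flux_measurable.
- exact: flux_integrable01.
- have := integrableD measurable_oo01 (flux_integrable01 u w) itcube.
  by apply: eq_integrable => //; exact: measurable_oo01.
move: (weak_gradD u (t *: w)) (weak_gradZ t w); apply: filterS2 => x.
by move=> /(_ I) -> /(_ I) ->; exact: signed_square_hemi.
Qed.

Lemma p_laplacian3_pseudomonotone : brezis_pseudomonotone (@p_laplacian3 R).
Proof.
apply: monotone_hemicontinuous_pseudomonotone.
  exact: p_laplacian3_mono.
exact: p_laplacian3_hemi.
Qed.

End p_laplacian.

(** * Weak convergence of oscillating sequences *)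

Section almost_orthogonal.
Context {R : realType}.
Local Notation leb := (@lebesgue_measure R).

(** The exponents run from n down to 1, never reaching 0, hence the bound 1 and not 2. *)
Lemma sum_half_pow_le (n : nat) : \sum_(a < n) (2^-1 : R) ^+ (n - a) <= 1.
Proof.
elim: n => [|n IH]; first by rewrite big_ord0 ler01.
rewrite big_ord_recr /= subSnn expr1.
have -> : \sum_(i < n) (2^-1 : R) ^+ (n.+1 - i) = 2^-1 * \sum_(i < n) (2^-1 : R) ^+ (n - i).
  by rewrite big_distrr /=; apply: eq_bigr => i _; rewrite -exprS subSn// ltnW.
by lra.
Qed.

Variables (g : nat -> R -> R) (s : nat -> R) (B : R).
Hypothesis g_cont : forall a, continuous (g a).
Hypothesis g_le : forall a t, 0 < t < 1 -> `|g a t| <= B.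
Hypothesis g_orth : forall a b, (a < b)%N ->
  `|\int[leb]_(t in `]0, 1[) (g a t * g b t)| <= B ^+ 2 * 2^-1 ^+ (b - a).
Hypothesis s_le : forall a, `|s a| <= 1.

Let B0 : 0 <= B.
Proof. by apply: le_trans (g_le 0 (t := 2^-1) _) => //; lra. Qed.

Let G n t := \sum_(a < n) s a * g a t.

Let G_cont n : continuous (G n).
Proof.
elim: n => [|n IH].
  rewrite (_ : G 0 = fun=> 0); first exact: continuous_fun_cst.
  by apply/funext => t; rewrite /G big_ord0.
rewrite (_ : G n.+1 = fun t => G n t + s n * g n t).
  apply: continuous_funD => //; apply: continuous_funM => //; exact: continuous_fun_cst.
by apply/funext => t; rewrite /G big_ord_recr.
Qed.

Let G_le n t : 0 < t < 1 -> `|G n t| <= n%:R * B.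
Proof.
move=> t01; elim: n => [|n IH]; first by rewrite /G big_ord0 normr0 mul0r.
rewrite /G big_ord_recr /= -natr1 mulrDl mul1r.
apply: le_trans (ler_normD _ _) _; apply: lerD => //.
rewrite normrM; apply: le_trans (g_le n t01).
by rewrite ler_piMl.
Qed.

Let G_orth n m : (m <= n)%N ->
  `|\int[leb]_(t in `]0, 1[) (G m t * g n t)| <= B ^+ 2 * \sum_(a < m) 2^-1 ^+ (n - a).
Proof.
elim: m => [_|m IH mn].
  rewrite big_ord0 mulr0 (_ : (fun t => _) = fun=> 0) ?Rintegral01_cst ?normr0//.
  by apply/funext => t; rewrite /G big_ord0 mul0r.
rewrite (_ : (fun t => _) = fun t => G m t * g n t + s m * (g m t * g n t)).
  rewrite Rintegral01D; [|exact: continuous_funM|].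
    rewrite Rintegral01Z; last exact: continuous_funM.
    apply: le_trans (ler_normD _ _) _.
    rewrite big_ord_recr /= mulrDr; apply: lerD; first exact/IH/ltnW.
    rewrite normrM; apply: le_trans (g_orth mn).
    by rewrite ler_piMl.
  by apply: continuous_funM; [exact: continuous_fun_cst|exact: continuous_funM].
by apply/funext => t; rewrite /G big_ord_recr /= mulrDl mulrA.
Qed.

(** Each new term adds at most B^2 for its own square and 2 B^2 for its cross term with the earlier
    sum, by [G_orth] and the geometric sum. *)
Let G_sqr n : \int[leb]_(t in `]0, 1[) (G n t ^+ 2) <= 3 * B ^+ 2 * n%:R.
Proof.
elim: n => [|n IH].
  rewrite mulr0 (_ : (fun t => _) = fun=> 0) ?Rintegral01_cst//.
  by apply/funext => t; rewrite /G big_ord0 expr0n.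
have cgg : continuous (fun t => g n t * g n t) by exact: continuous_funM.
have cGg : continuous (fun t => G n t * g n t) by exact: continuous_funM.
rewrite (_ : (fun t => _) = fun t => G n t ^+ 2 + (2 * s n * (G n t * g n t) +
    s n ^+ 2 * (g n t * g n t))); last first.
  by apply/funext => t; rewrite /G big_ord_recr /=; ring.
rewrite Rintegral01D; [|exact: continuous_funX|]; last first.
  by apply: continuous_funD; apply: continuous_funM;
    first [exact: continuous_fun_cst | exact: continuous_funM].
rewrite Rintegral01D; [|by apply: continuous_funM => //; exact: continuous_fun_cst..].
rewrite !Rintegral01Z// -[n.+1%:R]natr1 mulrDr mulr1; apply: lerD => //.
have i1 : \int[leb]_(t in `]0, 1[) (g n t * g n t) <= B ^+ 2.
  rewrite -[leRHS]Rintegral01_cst; apply: le_Rintegral01 => //.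
    exact: continuous_fun_cst.
  move=> t t01; have := g_le n t01; rewrite ler_norml => /andP[]; nra.
have i0 : 0 <= \int[leb]_(t in `]0, 1[) (g n t * g n t).
  by apply: Rintegral_ge0 => t _; rewrite -expr2 sqr_ge0.
have i2 := G_orth (leqnn n).
have i3 : B ^+ 2 * \sum_(a < n) 2^-1 ^+ (n - a) <= B ^+ 2 * 1.
  by apply: ler_wpM2l; [exact: sqr_ge0|exact: sum_half_pow_le].
move: i1 i0 (le_trans i2 i3).
set P := Rintegral _ _ _; set Q := Rintegral _ _ _ => i1 i0 i4.
have s1 : s n ^+ 2 <= 1.
  by rewrite -[leLHS]real_normK ?num_real// expr_le1.
have : s n ^+ 2 * P <= P by rewrite ler_piMl.
have : 2 * s n * Q <= 2 * `|Q|.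
  rewrite -mulrA ler_pM2l//; apply: le_trans (ler_norm _) _.
  by rewrite normrM ler_piMl.
by lra.
Qed.

(** The pointwise bound |G| <= n B reduces the cube to the square, whose integral grows only
    linearly. This gives n^2 in place of the trivial n^3. *)
Lemma almost_orthogonal_cube n :
  \int[leb]_(t in `]0, 1[) (`|\sum_(a < n) s a * g a t| ^+ 3) <= 3 * B ^+ 3 * n%:R ^+ 2.
Proof.
apply: (@le_trans _ _ (\int[leb]_(t in `]0, 1[) (n%:R * B * G n t ^+ 2))).
  apply: le_Rintegral01.
  - exact/continuous_funX/continuous_fun_norm/G_cont.
  - by apply: continuous_funM; [exact: continuous_fun_cst|exact: continuous_funX].
  move=> t t01; rewrite exprS real_normK ?num_real//.
  by apply: ler_wpM2r; [exact: sqr_ge0|exact: G_le].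
rewrite Rintegral01Z; last exact: continuous_funX.
have -> : 3 * B ^+ 3 * n%:R ^+ 2 = n%:R * B * (3 * B ^+ 2 * n%:R) by ring.
by apply: ler_wpM2l; [rewrite mulr_ge0|exact: G_sqr].
Qed.

End almost_orthogonal.

(** * Weak convergence to zero from the growth of norms of signed sums *)

Section weak_null.
Context {R : realType}.
Local Notation leb := (@lebesgue_measure R).
Local Notation leb01 := (@leb01 R).
Local Notation X := (@W013 R).

Lemma W01p_val0 : W01p_val (0 : X) = 0.
Proof. exact: (raddf0 val). Qed.

Lemma W013_funD (u v : X) : W1p_fun (W01p_val (u + v)) =
  (fun t => W1p_fun (W01p_val u) t + W1p_fun (W01p_val v) t) %[ae leb01].
Proof. by rewrite W01p_valD; exact: W1p_funD. Qed.

Lemma W013_funZ a (u : X) : W1p_fun (W01p_val (a *: u)) =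
  (fun t => a * W1p_fun (W01p_val u) t) %[ae leb01].
Proof. by rewrite W01p_valZ; exact: W1p_funZ. Qed.

Lemma W1p_fun_sum (u_ : nat -> X) (s : nat -> R) (w : nat -> R -> R) n :
  (forall k, W1p_fun (W01p_val (u_ k)) = w k %[ae leb01]) ->
  W1p_fun (W01p_val (\sum_(a < n) s a *: u_ a)) = (fun t => \sum_(a < n) s a * w a t) %[ae leb01].
Proof.
move=> uw; elim: n => [|n IH].
  rewrite big_ord0 W01p_val0 /W1p_fun W1p_pair0.
  by move: (Lfun_of0 leb01 (lee1n 3 : (1 <= 3%:R%:E :> \bar R)%E)); apply: filterS => t e _;
    rewrite e// big_ord0.
rewrite big_ord_recr /=.
move: IH; apply: filter_app; move: (uw n); apply: filter_app.
move: (W013_funD (\sum_(a < n) s a *: u_ a) (s n *: u_ n)) (W013_funZ (s n) (u_ n)).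
by apply: filterS2 => t e1 e2 e3 e4 _; rewrite e1// e2// e3// e4// big_ord_recr.
Qed.

Lemma weak_grad_sum (u_ : nat -> X) (s : nat -> R) (w : nat -> R -> R) n :
  (forall k, weak_grad (u_ k) = w k %[ae leb01]) ->
  weak_grad (\sum_(a < n) s a *: u_ a) = (fun t => \sum_(a < n) s a * w a t) %[ae leb01].
Proof.
move=> uw; elim: n => [|n IH].
  rewrite big_ord0 /weak_grad W01p_val0 /W1p_grad W1p_pair0.
  by move: (Lfun_of0 leb01 (lee1n 3 : (1 <= 3%:R%:E :> \bar R)%E)); apply: filterS => t e _;
    rewrite e// big_ord0.
rewrite big_ord_recr /=.
move: IH; apply: filter_app; move: (uw n); apply: filter_app.
move: (weak_gradD (\sum_(a < n) s a *: u_ a) (s n *: u_ n)) (weak_gradZ (s n) (u_ n)).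
by apply: filterS2 => t e1 e2 e3 e4 _; rewrite e1// e2// e3// e4// big_ord_recr.
Qed.

Lemma continuous_sum (s : nat -> R) (w : nat -> R -> R) n : (forall k, continuous (w k)) ->
  continuous (fun t => \sum_(a < n) s a * w a t).
Proof.
move=> cw; elim: n => [|n IH].
  by under eq_fun do rewrite big_ord0; exact: continuous_fun_cst.
under eq_fun do rewrite big_ord_recr /=.
by apply: continuous_funD => //; apply: continuous_funM => //; exact: continuous_fun_cst.
Qed.

Lemma dual_bound (f : dual X) : exists2 K : R, 0 < K & forall u, `|f u| <= K * `|u|.
Proof.
have := @continuous_linear_bounded R X R^o 0 (dual_val f) (@dual_continuous _ _ f 0).
move=> /linear_boundedP [M [_ hM]].
exists (Num.max M 0 + 1) => [|u]; first by rewrite ltr_wpDl// le_max lexx orbT.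
by apply: hM; rewrite ltr_pwDr// le_max lexx.
Qed.

(* [u_ k] is the element of X represented by [w k], which oscillates at frequency [2 ^ k]. *)
Variables (w w1 w2 : nat -> R -> R) (u_ : nat -> X) (B : R).
Hypothesis w_derive : forall k (t : R), is_derive t 1 (w k) (w1 k t).
Hypothesis w1_derive : forall k (t : R), is_derive t 1 (w1 k) (w2 k t).
Hypothesis w2_cont : forall k, continuous (w2 k).
Hypothesis w_bnd : forall k, w k 0 = 0 /\ w k 1 = 0.
Hypothesis w_le : forall k (t : R), 0 < t < 1 -> `|w k t| <= B * 2^-1 ^+ k.
Hypothesis w1_le : forall k (t : R), 0 < t < 1 -> `|w1 k t| <= B.
Hypothesis w2_le : forall k (t : R), 0 < t < 1 -> `|w2 k t| <= B * 2 ^+ k.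
Hypothesis u_fun : forall k, W1p_fun (W01p_val (u_ k)) = w k %[ae leb01].
Hypothesis u_grad : forall k, weak_grad (u_ k) = w1 k %[ae leb01].

Let B0 : 0 <= B.
Proof. by apply: le_trans (w1_le 0 (t := 2^-1) _) => //; lra. Qed.

Let w_cont k : continuous (w k) := is_derive_continuous (w_derive k).
Let w1_cont k : continuous (w1 k) := is_derive_continuous (w1_derive k).

Let Rintegral01_le (f : R -> R) (c : R) : continuous f ->
  (forall t : R, 0 < t < 1 -> `|f t| <= c) ->
  `|\int[leb]_(t in `]0, 1[) f t| <= c.
Proof.
move=> cf fc; apply: le_trans (le_normr_Rintegral measurable_oo01 (continuous_integrable01 cf)) _.
rewrite -[leRHS]Rintegral01_cst; apply: le_Rintegral01 => //.
- exact: continuous_fun_norm.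
- exact: continuous_fun_cst.
Qed.

Let half_pow_sub (i j : nat) : (i <= j)%N -> 2 ^+ i * 2^-1 ^+ j = 2^-1 ^+ (j - i) :> R.
Proof.
move=> ij; rewrite -{1}(subnK ij) exprD mulrCA -exprMn divff// expr1n mulr1//.
Qed.

(** No cancellation is used: the amplitude of [w j] alone is small enough. *)
Let w_gram i j : (i < j)%N ->
  `|\int[leb]_(t in `]0, 1[) (w i t * w j t)| <= B ^+ 2 * 2^-1 ^+ (j - i).
Proof.
move=> ij; apply: Rintegral01_le; first exact: continuous_funM.
move=> t t01; rewrite normrM.
apply: (@le_trans _ _ (B * (B * 2^-1 ^+ (j - i)))); last by rewrite mulrA.
apply: ler_pM => //.
  apply: le_trans (w_le i t01) _; rewrite ler_piMr// exprn_ile1// invf_le1//; lra.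
apply: le_trans (w_le j t01) _; apply: ler_wpM2l => //.
by apply: ler_wiXn2l; [lra|lra|exact: leq_subr].
Qed.

(** Integration by parts moves a derivative from the faster factor to the slower one, costing 2^i
    and gaining 2^-j. *)
Let w1_gram i j : (i < j)%N ->
  `|\int[leb]_(t in `]0, 1[) (w1 i t * w1 j t)| <= B ^+ 2 * 2^-1 ^+ (j - i).
Proof.
move=> ij; have [e0 e1] := w_bnd j.
rewrite (@Rintegral01_by_parts _ (w1 i) (w2 i) (w j) (w1 j))//; last 2 first.
- by rewrite e0 mulr0.
- by rewrite e1 mulr0.
rewrite normrN; apply: Rintegral01_le; first exact: continuous_funM.
move=> t t01; rewrite normrM.
apply: le_trans (ler_pM (normr_ge0 _) (normr_ge0 _) (w2_le i t01) (w_le j t01)) _.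
by rewrite mulrACA half_pow_sub// ltnW.
Qed.

Lemma oscillating_norm_sum (k : nat -> nat) (s : nat -> R) n :
  (forall a b, (a < b)%N -> (k a < k b)%N) -> (forall a, `|s a| <= 1) ->
  `|\sum_(a < n) s a *: u_ (k a)| ^+ 3 <= 24 * B ^+ 3 * n%:R ^+ 2.
Proof.
move=> kmono s1.
(* Strictly increasing indices spread at least as fast as their positions, so the decay of the Gram
   matrix passes to subsequences. *)
have kge a b : (a <= b)%N -> (b - a <= k b - k a)%N.
  move=> ab; rewrite -(subnK ab); move: (b - a)%N => d.
  suff : (k a + d <= k (d + a))%N by lia.
  elim: d => [|d IH]; first by rewrite add0n addn0.
  have : (k (d + a) < k (d.+1 + a))%N by apply: kmono; rewrite addSn.
  by lia.
have gram (v : nat -> R -> R) :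
    (forall i j, (i < j)%N ->
      `|\int[leb]_(t in `]0, 1[) (v i t * v j t)| <= B ^+ 2 * 2^-1 ^+ (j - i)) ->
    forall a b, (a < b)%N ->
      `|\int[leb]_(t in `]0, 1[) (v (k a) t * v (k b) t)| <= B ^+ 2 * 2^-1 ^+ (b - a).
  move=> h a b ab; apply: le_trans (h _ _ (kmono _ _ ab)) _.
  apply: ler_wpM2l; first exact: sqr_ge0.
  by apply: ler_wiXn2l; [lra|lra|exact/kge/ltnW].
have wB j (t : R) : 0 < t < 1 -> `|w j t| <= B.
  move=> t01; apply: le_trans (w_le j t01) _.
  by rewrite ler_piMr// exprn_ile1//; lra.
have W0 := almost_orthogonal_cube (fun a => @w_cont (k a)) (fun a => wB (k a))
  (gram _ w_gram) s1 n.
have W1 := almost_orthogonal_cube (fun a => @w1_cont (k a)) (fun a => @w1_le (k a))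
  (gram _ w1_gram) s1 n.
set u := \sum_(a < n) _.
have e0 := W1p_fun_sum s n (fun a => u_fun (k a)).
have e1 := weak_grad_sum s n (fun a => u_grad (k a)).
have c0 := @continuous_sum s _ n (fun a => @w_cont (k a)).
have c1 := @continuous_sum s _ n (fun a => @w1_cont (k a)).
have n0 := Lspace_norm3 c0 e0.
have n1 := Lspace_norm3 c1 e1.
rewrite -/u in n0 n1.
rewrite -n0 in W0; rewrite -n1 in W1.
rewrite W013_normE.
move: (normr_ge0 (W01p_val u).1) (normr_ge0 (W01p_val u).2) W0 W1.
move: `|(W01p_val u).1| `|(W01p_val u).2| (B ^+ 3) => a b B3 a0 b0 W0 W1.
(* Convexity of the cube; with 3 B^3 n^2 for the function and for its gradient it gives the constant
   24. *)
have : (a + b) ^+ 3 <= 4 * (a ^+ 3 + b ^+ 3).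
  have : 0 <= (a + b) * (a - b) ^+ 2 by rewrite mulr_ge0 ?sqr_ge0 ?addr_ge0.
  have -> : 4 * (a ^+ 3 + b ^+ 3) = (a + b) ^+ 3 + 3 * ((a + b) * (a - b) ^+ 2) by ring.
  by lra.
by lra.
Qed.

Lemma oscillating_weak_null : weak_cvg u_ 0.
Proof.
move=> f; rewrite linear0; apply/cvgr0Pnorm_le => e e0.
apply: contrapT => nf.
have far n : exists m, (n <= m)%N /\ e < `|f (u_ m)|.
  apply: contrapT => nm; apply: nf; exists n => // m /= nm'.
  rewrite leNgt; apply/negP => em; apply: nm; exists m; split => //.
have [h hP] := choice far.
(* If f does not tend to 0 along [u_], it exceeds e arbitrarily far out; restarting each search at
   [(k a').+1] makes the selected indices strictly increasing. *)
pose k := fix k a := if a is a'.+1 then h (k a').+1 else h 0%N.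
have kfar a : e <= `|f (u_ (k a))| by case: a => [|a]; apply/ltW; exact: (hP _).2.
have kS a : (k a < k a.+1)%N by exact: (hP _).1.
have kmono a b : (a < b)%N -> (k a < k b)%N.
  elim: b => [//|b IH]; rewrite ltnS leq_eqVlt => /predU1P[->//|/IH ab].
  exact: ltn_trans ab (kS b).
(* These signs make f add up absolute values on the signed sum. *)
pose s a : R := if 0 <= f (u_ (k a)) then 1 else -1.
have s1 a : `|s a| <= 1 by rewrite /s; case: ifP; rewrite ?normrN normr1.
have sf a : s a * f (u_ (k a)) = `|f (u_ (k a))|.
  rewrite /s; case: (leP 0 (f (u_ (k a)))) => h0.
    by rewrite mul1r ger0_norm.
  by rewrite mulN1r ltr0_norm.
have [K K0 fK] := dual_bound f.
have bnd n : n%:R * e <= K * `|\sum_(a < n) s a *: u_ (k a)|.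
  apply: le_trans (fK _); apply: le_trans (ler_norm _).
  rewrite linear_sum /=.
  under eq_bigr do rewrite linearZ /= [_ *: _]sf.
  rewrite -[n in n%:R]card_ord mulr_natl -sumr_const.
  by apply: ler_sum => a _.
(* The value of f on the sum is at least n e while the norm is O(n^(2/3)); cubing and cancelling n^2
   leaves a linear quantity bounded by a constant. *)
have cub n : n.+1%:R * e ^+ 3 <= K ^+ 3 * (24 * B ^+ 3).
  have n0 : 0 < n.+1%:R ^+ 2 :> R by rewrite exprn_gt0// ltr0n.
  rewrite -(ler_pM2l n0).
  have N3 := oscillating_norm_sum n.+1 kmono s1.
  have : (n.+1%:R * e) ^+ 3 <= (K * `|\sum_(a < n.+1) s a *: u_ (k a)|) ^+ 3.
    by rewrite lerXn2r ?nnegrE// ?mulr_ge0// ltW.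
  rewrite [leRHS]exprMn => /le_trans/(_ (ler_wpM2l _ N3)) => le.
  have {}le := le (exprn_ge0 3 (ltW K0)).
  have -> : n.+1%:R ^+ 2 * (n.+1%:R * e ^+ 3) = (n.+1%:R * e) ^+ 3 by ring.
  have -> : n.+1%:R ^+ 2 * (K ^+ 3 * (24 * B ^+ 3)) = K ^+ 3 * (24 * B ^+ 3 * n.+1%:R ^+ 2) by ring.
  exact: le.
have e30 : 0 < e ^+ 3 by rewrite exprn_gt0.
have := cub (Num.truncn (K ^+ 3 * (24 * B ^+ 3) / e ^+ 3)).
rewrite leNgt => /negP; apply; rewrite -ltr_pdivrMr//.
exact: truncnS_gt.
Qed.

End weak_null.

(** * Failure of Ky-Fan hemicontinuity *)

Section oscillation.
Context {R : realType}.
Local Notation leb := (@lebesgue_measure R).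
Local Notation leb01 := (@leb01 R).
Local Notation X := (@W013 R).
Local Notation phi := (@bump01 R).
Local Notation phi1 := (derive1n 1 (@bump01 R)).
Local Notation phi2 := (derive1n 2 (@bump01 R)).

Lemma bump01_test : test_function phi.
Proof. by apply: smooth_test_function; [exact: smooth_bump01|exact: bump01_supp]. Qed.

Lemma bump01_derive n (x : R) : is_derive x 1 (derive1n n phi) (derive1n n.+1 phi x).
Proof.
rewrite derive1nS derive1E; apply/derivableP/smooth_derivable; exact: smooth_bump01.
Qed.

Lemma bump01_continuous n : continuous (derive1n n phi).
Proof. exact: is_derive_continuous (bump01_derive n). Qed.

(** The mean value theorem is applied to phi^2 on [0, 1/2], not to phi: its derivative 2 phi phi' is
    nonzero somewhere, which makes both factors nonzero at one point. *)
Lemma bump01_slope : exists2 c : R, 0 < c < 1 & phi c != 0 /\ phi1 c != 0.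
Proof.
have [c c0 e] : exists2 c : R, c \in `]0, 2^-1[%R &
    phi 2^-1 ^+ 2 - phi 0 ^+ 2 = 2 * (phi c * phi1 c) * (2^-1 - 0).
  apply: (@MVT R (fun x => phi x ^+ 2) (fun x => 2 * (phi x * phi1 x))); first by rewrite invr_gt0.
    move=> x _.
    have := @is_deriveM R R phi phi x 1 _ _ (bump01_derive 0 x) (bump01_derive 0 x).
    rewrite /GRing.scale /=.
    rewrite (_ : _ + _ = 2 * (phi x * phi1 x)); last by rewrite -mulr2n mulr_natl.
    by rewrite (_ : phi * phi = fun x => phi x ^+ 2)//; apply/funext => y; rewrite expr2.
  exact/continuous_subspaceT/continuous_funX/(@bump01_continuous 0).
exists c.
  by move: c0; rewrite in_itv/= => /andP[a b]; apply/andP; split; lra.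
have b0 : phi (0 : R) = 0 by apply: bump01_supp; rewrite negb_and -leNgt invr_ge0 ler0n.
have : phi (2^-1 : R) ^+ 2 != 0 by rewrite expf_neq0 ?bump01_half.
move: e; rewrite b0 expr0n /= subr0 => -> ne.
by split; apply: contraNneq ne => ->; rewrite ?mul0r ?mulr0 ?mul0r.
Qed.

(** The amplitude 2^-k offsets the frequency 2^k, so the gradient [osc1] stays bounded without
    becoming small. The phases 0 and pi / 2 are used together. *)
Definition osc (th : R) k (t : R) : R := 2^-1 ^+ k * (phi t * sin (2 ^+ k * t + th)).
Definition osc1 (th : R) k (t : R) : R :=
  2^-1 ^+ k * (phi1 t * sin (2 ^+ k * t + th)) + phi t * cos (2 ^+ k * t + th).
Definition osc2 (th : R) k (t : R) : R :=
  2^-1 ^+ k * (phi2 t * sin (2 ^+ k * t + th)) + 2 * (phi1 t * cos (2 ^+ k * t + th)) +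
  - 2 ^+ k * (phi t * sin (2 ^+ k * t + th)).

Let half_pow k : 2^-1 ^+ k * 2 ^+ k = 1 :> R.
Proof. by rewrite -exprMn mulVf// expr1n. Qed.

Let sin_derive th k (t : R) : is_derive t 1 (fun x : R => sin (2 ^+ k * x + th))
  (2 ^+ k * cos (2 ^+ k * t + th)).
Proof. by apply: is_derive_affine; exact: is_derive_sin. Qed.

Let cos_derive th k (t : R) : is_derive t 1 (fun x : R => cos (2 ^+ k * x + th))
  (2 ^+ k * - sin (2 ^+ k * t + th)).
Proof. by apply: is_derive_affine; exact: is_derive_cos. Qed.

Let prodD (f g : R -> R) (df dg : R) (t : R) : is_derive t 1 f df -> is_derive t 1 g dg ->
  is_derive t 1 (fun x => f x * g x) (f t * dg + g t * df).
Proof. by move=> fd gd; exact: (@is_deriveM R R f g t 1). Qed.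

Let scaleD (f : R -> R) (c df : R) (t : R) : is_derive t 1 f df ->
  is_derive t 1 (fun x => c * f x) (c * df).
Proof. by move=> fd; exact: (@is_deriveZ R R R f c t 1). Qed.

Let sumD (f g : R -> R) (df dg : R) (t : R) : is_derive t 1 f df -> is_derive t 1 g dg ->
  is_derive t 1 (fun x => f x + g x) (df + dg).
Proof. by move=> fd gd; exact: (@is_deriveD R R R f g t 1). Qed.

Lemma osc_derive th k (t : R) : is_derive t 1 (osc th k) (osc1 th k t).
Proof.
have := scaleD (2^-1 ^+ k) (prodD (bump01_derive 0 t) (sin_derive th k t)).
rewrite (_ : 2^-1 ^+ k * _ = osc1 th k t)// /osc1 /derive1n /=.
set S := sin _; set C := cos _; set p0 := phi t; set p1 := derive1 phi t.
rewrite mulrDr (_ : 2^-1 ^+ k * (p0 * (2 ^+ k * C)) = (2^-1 ^+ k * 2 ^+ k) * (p0 * C)); last ring.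
by rewrite half_pow; ring.
Qed.

Lemma osc1_derive th k (t : R) : is_derive t 1 (osc1 th k) (osc2 th k t).
Proof.
have := sumD (scaleD (2^-1 ^+ k) (prodD (bump01_derive 1 t) (sin_derive th k t)))
  (prodD (bump01_derive 0 t) (cos_derive th k t)).
rewrite (_ : 2^-1 ^+ k * _ + _ = osc2 th k t)// /osc2.
set S := sin _; set C := cos _; rewrite /derive1n /=.
set p0 := phi t; set p1 := derive1 phi t; set p2 := derive1 (derive1 phi) t.
rewrite mulrDr (_ : 2^-1 ^+ k * (p1 * (2 ^+ k * C)) = (2^-1 ^+ k * 2 ^+ k) * (p1 * C)); last ring.
by rewrite half_pow; ring.
Qed.

Lemma smooth_osc th k : smooth (osc th k).
Proof.
apply: smoothM; first by move=> n; exact: Cn_cst.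
apply: smoothM; first exact: smooth_bump01.
by apply: smooth_affine => n; exact: (Cn_sin_cos n).1.
Qed.

Lemma osc_test th k : test_function (osc th k).
Proof.
apply: smooth_test_function; first exact: smooth_osc.
by move=> x x01; rewrite /osc bump01_supp// mul0r mulr0.
Qed.

Lemma osc2_continuous th k : continuous (osc2 th k).
Proof.
have cst_cont := @continuous_fun_cst R.
have cs := is_derive_continuous (sin_derive th k).
have cc := is_derive_continuous (cos_derive th k).
by apply: continuous_funD; [apply: continuous_funD|];
  apply: continuous_funM => //; apply: continuous_funM => //;
  first [exact: (@bump01_continuous 0)|exact: bump01_continuous].
Qed.

Let sin_le (x : R) : `|sin x| <= 1.
Proof. by rewrite ler_norml sin_geN1 sin_le1. Qed.

Let cos_le (x : R) : `|cos x| <= 1.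
Proof. by rewrite ler_norml cos_geN1 cos_le1. Qed.

Lemma osc_bounds : exists2 B : R, 0 < B & forall th k (t : R), 0 < t < 1 ->
  [/\ `|osc th k t| <= B * 2^-1 ^+ k, `|osc1 th k t| <= B, `|osc2 th k t| <= B * 2 ^+ k
    & `|phi1 t| <= B].
Proof.
have [b0 b00 h0] := continuous_bound01 (@bump01_continuous 0).
have [b1 b10 h1] := continuous_bound01 (@bump01_continuous 1).
have [b2 b20 h2] := continuous_bound01 (@bump01_continuous 2).
(* Read off from [osc2], whose three terms are bounded by b2, 2 b1 and 2^k b0; the other bounds are
   weaker. *)
exists (b0 + 2 * b1 + b2); first lra.
move=> th k t t01; have {}h0 := h0 t t01; have {}h1 := h1 t t01; have {}h2 := h2 t t01.
rewrite /osc /osc1 /osc2.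
have S1 := sin_le (2 ^+ k * t + th); have C1 := cos_le (2 ^+ k * t + th).
set S := sin _ in S1 *; set C := cos _ in C1 *.
have p0 : 0 <= 2^-1 ^+ k :> R by rewrite exprn_ge0.
have p1 : 2^-1 ^+ k <= 1 :> R by rewrite exprn_ile1//; lra.
have q1 : 1 <= 2 ^+ k :> R by rewrite exprn_ege1//; lra.
have mulS (x y b : R) : `|x| <= b -> `|y| <= 1 -> `|x * y| <= b.
  by move=> xb y1; rewrite normrM; apply: le_trans xb; rewrite ler_piMr.
have k0 := mulS _ _ _ h0 S1; have k0' := mulS _ _ _ h0 C1.
have k1 := mulS _ _ _ h1 S1; have k1' := mulS _ _ _ h1 C1.
have k2 := mulS _ _ _ h2 S1.
have mulp (x b : R) : `|x| <= b -> `|2^-1 ^+ k * x| <= b.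
  move=> xb; rewrite normrM (ger0_norm p0); apply: le_trans xb.
  by rewrite ler_piMl.
split.
- rewrite normrM (ger0_norm p0) mulrC; apply: ler_wpM2r => //.
  by apply: le_trans k0 _; lra.
- apply: le_trans (ler_normD _ _) _.
  by have := mulp _ _ k1; move: k0'; rewrite /derive1n /=; lra.
- apply: le_trans (ler_normD _ _) _; apply: le_trans (lerD (ler_normD _ _) (lexx _)) _.
  have := mulp _ _ k2.
  rewrite [`|2 * _|]normrM [`|- _ * _|]normrM normrN (ger0_norm (_ : 0 <= 2))//.
  rewrite (ger0_norm (_ : 0 <= 2 ^+ k)); last lra.
  move: k0 k1'; set x := `|_ * S|; set y := `|_ * C| => k0 k1' k3.
  have : b2 <= b2 * 2 ^+ k by rewrite ler_peMr// ltW.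
  have : b1 <= b1 * 2 ^+ k by rewrite ler_peMr// ltW.
  have : 2 ^+ k * x <= 2 ^+ k * b0 by rewrite ler_wpM2l//; lra.
  by lra.
- by apply: le_trans h1 _; lra.
Qed.

(** A quarter turn sends (sin, cos) to (cos, -sin), so the two squares add up to phi^2 + (2^-k
    phi')^2 and the oscillation cancels. The lower bound is thus free of k. *)
Lemma osc1_sum_sqr k (t : R) : phi t ^+ 2 <= osc1 0 k t ^+ 2 + osc1 (pi / 2) k t ^+ 2.
Proof.
rewrite /osc1 addr0 sinDpihalf cosDpihalf.
have := cos2Dsin2 (2 ^+ k * t).
set S := sin _; set C := cos _; set p := _ ^+ k; set f0 := phi t; set f1 := phi1 t => SC.
have -> : (p * (f1 * S) + f0 * C) ^+ 2 + (p * (f1 * C) + f0 * - S) ^+ 2 =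
  (C ^+ 2 + S ^+ 2) * ((p * f1) ^+ 2 + f0 ^+ 2) by ring.
by rewrite SC mul1r lerDr sqr_ge0.
Qed.

End oscillation.

(** * The contradiction with Ky-Fan hemicontinuity *)

Section not_ky_fan.
Context {R : realType}.
Local Notation leb := (@lebesgue_measure R).
Local Notation leb01 := (@leb01 R).
Local Notation X := (@W013 R).
Local Notation F := (@p_laplacian3 R).
Local Notation phi := (@bump01 R).
Local Notation phi1 := (derive1n 1 (@bump01 R)).

Lemma weak_cvg_shift (x : X) (z_ : nat -> X) (c : R) :
  weak_cvg z_ 0 -> weak_cvg (fun k => x + c *: z_ k) x.
Proof.
move=> z0 f; have := z0 f; rewrite linear0 => fz.
have -> : (fun k => f (x + c *: z_ k)) = (fun k => f x + c * f (z_ k)).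
  by apply/funext => k; rewrite linearD linearZ.
have : (f x + c * f (z_ k) : R) @[k --> \oo] --> (f x + c * 0 : R).
  by apply: cvgD; [exact: cvg_cst|exact: cvgMr fz].
by rewrite mulr0 addr0.
Qed.

Lemma ky_fan_shift (x : X) (z_ : nat -> X) (c s C : R) : ky_fan_hemicontinuous F ->
  weak_cvg z_ 0 -> (forall k, c * F (x + c *: z_ k) (z_ k) <= C) ->
  \forall k \near \oo, s * (F (x + c *: z_ k) x - F x x) <= C + 1.
Proof.
move=> KF z0 zC.
(* At this test point the lower limit compares - s F x x with c F u z_k - s F u x. Passing from the
   lower limit to an eventual inequality costs the slack 1. *)
have := KF (x + s *: x) _ x (@weak_cvg_shift x z_ c z0).
move=> /limn_einf_ge_near/(_ 1 ltr01); apply: filterS => k.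
have -> : x - (x + s *: x) = - (s *: x) by rewrite opprD addrA subrr add0r.
have -> : x + c *: z_ k - (x + s *: x) = c *: z_ k - s *: x.
  by rewrite opprD addrACA addrA subrr add0r.
have -> : F x (- (s *: x)) = - (s * F x x) by rewrite linearN linearZ.
set u := x + _.
have -> : F u (c *: z_ k - s *: x) = c * F u (z_ k) - s * F u x.
  by rewrite linearB; congr (_ - _); rewrite linearZ.
by have := zC k; rewrite -/u; lra.
Qed.

Lemma p_laplacian3_ae (u v : X) (p q : R -> R) : continuous p -> continuous q ->
  weak_grad u = p %[ae leb01] -> weak_grad v = q %[ae leb01] ->
  F u v = \int[leb]_(t in `]0, 1[) (`|p t| * p t * q t).
Proof.
move=> cp cq up vq; rewrite p_laplacian3E; apply: eq_Rintegral01_ae.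
- exact: flux_measurable.
- apply: continuous_measurable_fun; apply: continuous_funM => //.
  by apply: continuous_funM => //; exact: continuous_fun_norm.
- by move: up vq; apply: filterS2 => t e1 e2 _; rewrite e1// e2.
Qed.

Lemma p_laplacian3_not_ky_fan : ~ ky_fan_hemicontinuous F.
Proof.
move=> KF.
have [B B0 hB] := @osc_bounds R.
have [x [_ xg]] := embed_test_function (@bump01_test R).
have [z0 z0P] := choice (fun k => embed_test_function (@osc_test R 0 k)).
have [z1 z1P] := choice (fun k => embed_test_function (@osc_test R (pi / 2) k)).
have osc1E th k : derive1 (@osc R th k) = osc1 th k.
  exact: is_derive_derive1 (osc_derive th k).
have osc1_cont th k : continuous (@osc1 R th k) := is_derive_continuous (osc1_derive th k).
have phi1_cont : continuous phi1 by exact: bump01_continuous.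
have null th (z : nat -> X) :
    (forall k, W1p_fun (W01p_val (z k)) = osc th k %[ae leb01] /\
      weak_grad (z k) = derive1 (osc th k) %[ae leb01]) -> weak_cvg z 0.
  move=> zP; apply: (@oscillating_weak_null R (osc th) (osc1 th) (osc2 th) z B).
  - exact: osc_derive.
  - exact: osc1_derive.
  - exact: osc2_continuous.
  - by move=> k; exact: test_function_bnd (osc_test th k).
  - by move=> k t /(hB th k)[].
  - by move=> k t /(hB th k)[].
  - by move=> k t /(hB th k)[].
  - by move=> k; exact: (zP k).1.
  - by move=> k; rewrite -osc1E; exact: (zP k).2.
have shift_grad th (z : nat -> X) (c : R) k :
    weak_grad (z k) = derive1 (osc th k) %[ae leb01] ->
    weak_grad (x + c *: z k) = (fun t => phi1 t + c * osc1 th k t) %[ae leb01].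
  move=> zg; move: xg; apply: filter_app; move: zg; apply: filter_app.
  move: (weak_gradD x (c *: z k)) (weak_gradZ c (z k)).
  by apply: filterS2 => t e1 e2 e3 e4 _; rewrite e1// e2// e3// e4// osc1E.
have shift_cont th c k : continuous (fun t => phi1 t + c * osc1 th k t).
  apply: continuous_funD => //; apply: continuous_funM => //; exact: continuous_fun_cst.
have bound th (z : nat -> X) (c : R) :
    (forall k, weak_grad (z k) = derive1 (osc th k) %[ae leb01]) -> `|c| = 1 ->
    forall k, c * F (x + c *: z k) (z k) <= 4 * B ^+ 3.
  move=> zg c1 k; have := zg k; rewrite osc1E => zk.
  rewrite (p_laplacian3_ae (shift_cont th c k) (osc1_cont th k) (shift_grad _ _ _ _ (zg k)) zk).
  apply: le_trans (ler_norm _) _; rewrite normrM c1 mul1r.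
  set f := fun t : R => `|phi1 t + c * osc1 th k t| * (phi1 t + c * osc1 th k t) * osc1 th k t.
  have cf : continuous f.
    by apply: continuous_funM => //; apply: continuous_funM => //; exact: continuous_fun_norm.
  apply: le_trans (le_normr_Rintegral measurable_oo01 (continuous_integrable01 cf)) _.
  rewrite -[leRHS]Rintegral01_cst; apply: le_Rintegral01.
  - exact: continuous_fun_norm.
  - exact: continuous_fun_cst.
  move=> t t01; have [_ o1 _ p1] := hB th k t t01.
  rewrite /f !normrM normr_id.
  have le2 : `|phi1 t + c * osc1 th k t| <= 2 * B.
    by apply: le_trans (ler_normD _ _) _; rewrite normrM c1 mul1r; lra.
  have -> : 4 * B ^+ 3 = 2 * B * (2 * B) * B by ring.
  by rewrite !ler_pM// mulr_ge0.
(* Up to the factor B^2, this bounds the summed second differences from below for every k. *)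
pose D (t : R) := `|phi1 t| ^+ 3 * phi t ^+ 2.
have D_cont : continuous D.
  apply: continuous_funM; first exact/continuous_funX/continuous_fun_norm.
  exact/continuous_funX/(@bump01_continuous R 0).
pose d := \int[leb]_(t in `]0, 1[) D t.
have d0 : 0 < d.
  have [c c01 [pc p1c]] := @bump01_slope R.
  apply: (Rintegral01_gt0 D_cont _ c01) => [t|].
    by rewrite mulr_ge0 ?sqr_ge0// exprn_ge0.
  by apply: mulr_gt0; [rewrite exprn_gt0 ?normr_gt0|rewrite exprn_even_gt0].
(* Makes s d / B^2 exceed by 1 the sum of the four upper bounds 4 B^3 + 1. *)
pose s := B ^+ 2 * (4 * (4 * B ^+ 3 + 1) + 1) / d.
have E th z c (zP : forall k, W1p_fun (W01p_val (z k)) = osc th k %[ae leb01] /\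
      weak_grad (z k) = derive1 (osc th k) %[ae leb01]) (c1 : `|c| = 1) :=
  ky_fan_shift s KF (null th z zP) (bound th z c (fun k => (zP k).2) c1).
have n1 : `|1 : R| = 1 by exact: normr1.
have nN1 : `|-1 : R| = 1 by rewrite normrN normr1.
(* A single index k has to serve both phases and both signs. *)
have [k [[E1 E2] [E3 E4]]] := filter_ex (filterI
  (filterI (E _ _ _ z0P n1) (E _ _ _ z0P nN1)) (filterI (E _ _ _ z1P n1) (E _ _ _ z1P nN1))).
have Fxx := p_laplacian3_ae phi1_cont phi1_cont xg xg.
have Fs th z c : (forall k, weak_grad (z k) = derive1 (osc th k) %[ae leb01]) ->
    F (x + c *: z k) x = \int[leb]_(t in `]0, 1[) (`|phi1 t + c * osc1 th k t| *
      (phi1 t + c * osc1 th k t) * phi1 t).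
  by move=> zg; exact: p_laplacian3_ae (shift_cont th c k) phi1_cont (shift_grad _ _ _ _ (zg k)) xg.
have z0g j := (z0P j).2; have z1g j := (z1P j).2.
rewrite (Fs _ _ _ z0g) Fxx in E1; rewrite (Fs _ _ _ z0g) Fxx in E2.
rewrite (Fs _ _ _ z1g) Fxx in E3; rewrite (Fs _ _ _ z1g) Fxx in E4.
pose a t := phi1 t.
pose J th c := \int[leb]_(t in `]0, 1[) (`|a t + c * osc1 th k t| * (a t + c * osc1 th k t) * a t).
pose I0 := \int[leb]_(t in `]0, 1[) (`|a t| * a t * a t).
have flux_cont (p : R -> R) : continuous p -> continuous (fun t => `|p t| * p t * a t).
  by move=> cp; apply: continuous_funM => //; apply: continuous_funM => //;
    exact: continuous_fun_norm.
(* Adding the signs 1 and -1 cancels the first-order effect of the oscillation and leaves this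
   second difference, tested against phi'. *)
pose h th (t : R) := (`|a t + osc1 th k t| * (a t + osc1 th k t) +
  `|a t - osc1 th k t| * (a t - osc1 th k t) - 2 * (`|a t| * a t)) * a t.
have hE th : h th = fun t => (`|a t + 1 * osc1 th k t| * (a t + 1 * osc1 th k t) * a t +
    `|a t + -1 * osc1 th k t| * (a t + -1 * osc1 th k t) * a t) + -2 * (`|a t| * a t * a t).
  by apply/funext => t; rewrite /h mul1r mulN1r; ring.
have c2 : continuous (fun t => -2 * (`|a t| * a t * a t)).
  by apply: continuous_funM; [exact: continuous_fun_cst|exact: flux_cont].
have c1 th : continuous (fun t => `|a t + 1 * osc1 th k t| * (a t + 1 * osc1 th k t) * a t +
    `|a t + -1 * osc1 th k t| * (a t + -1 * osc1 th k t) * a t).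
  by apply: continuous_funD; apply: flux_cont; exact: shift_cont.
have h_cont th : continuous (h th) by rewrite hE; exact: continuous_funD.
have hI th : \int[leb]_(t in `]0, 1[) h th t = J th 1 + J th (-1) - 2 * I0.
  rewrite hE Rintegral01D// Rintegral01D; [|apply: flux_cont; exact: shift_cont..].
  by rewrite Rintegral01Z ?mulNr//; exact: flux_cont.
(* The pointwise second-difference bound is used with M = B for each phase; [osc1_sum_sqr] then
   removes k. *)
have dh : d <= B ^+ 2 * (\int[leb]_(t in `]0, 1[) h 0 t + \int[leb]_(t in `]0, 1[) h (pi / 2) t).
  rewrite -Rintegral01D// -Rintegral01Z; last exact: continuous_funD.
  apply: le_Rintegral01 => //.
    by apply: continuous_funM; [exact: continuous_fun_cst|exact: continuous_funD].
  move=> t t01.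
  have [_ o1 _ p1] := hB 0 k t t01; have [_ o1' _ _] := hB (pi / 2) k t t01.
  rewrite mulrDr.
  apply: le_trans (lerD (signed_square_second_difference p1 o1)
    (signed_square_second_difference p1 o1')).
  rewrite -mulrDr; apply: ler_wpM2l; first by rewrite exprn_ge0.
  exact: osc1_sum_sqr.
rewrite !hI in dh.
have : s * (d / B ^+ 2) <= 4 * (4 * B ^+ 3 + 1).
  apply: (@le_trans _ _ (s * (J 0 1 + J 0 (-1) - 2 * I0 +
    (J (pi / 2) 1 + J (pi / 2) (-1) - 2 * I0)))).
    apply: ler_wpM2l.
      by rewrite !mulr_ge0 ?invr_ge0 ?ltW// !(addr_gt0, mulr_gt0)// exprn_gt0.
    by rewrite ler_pdivrMr ?exprn_gt0// mulrC.
  move: E1 E2 E3 E4.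
  by rewrite -/(J 0 1) -/(J 0 (-1)) -/(J (pi / 2) 1) -/(J (pi / 2) (-1)) -/I0; lra.
have -> : s * (d / B ^+ 2) = 4 * (4 * B ^+ 3 + 1) + 1.
  by rewrite /s; field; rewrite ?gt_eqF// exprn_gt0.
by lra.
Qed.

End not_ky_fan.

Theorem mainTheorem1 (R : realType) :
  brezis_pseudomonotone (@p_laplacian3 R) /\
  ~ ky_fan_hemicontinuous (@p_laplacian3 R).
Proof.
split; first exact: p_laplacian3_pseudomonotone.
exact: p_laplacian3_not_ky_fan.
Qed.
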